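(* Take any $n\ge 5$. Suppose that $K$ is a norm on $\mathbb{R}^n$ and $Y\sim N_n(\mu,\sigma^2 I_n)$ for some $\mu\in\mathbb{R}^n$ and $\sigma\ge 0$. Let $Z\sim N_n(0,I_n)$ be defined on the same probability space as $Y$. Define \[ \hat\sigma := \frac{K(Y)}{K(Z)}. \] Let $K^\circ$ be the dual norm of $K$. For each $k\ge 1$, let $m_k := \bigl(\mathbb{E}(K^\circ(Z)^k)\bigr)^{1/k}$. Let \[ a := \sup\{\|v\| : v\in\mathbb{R}^n,\ K^\circ(v)\le 1\}. \] Then \[ \mathbb{E}(\hat\sigma-\sigma)^2\le \frac{K(\mu)^2 m_2^2}{(n-2)^2} + \frac{32\sqrt{2}\,\sigma^2a^2m_4^2}{(n-4)^2}. \]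
   Context: $\|\cdot\|$ is the Euclidean norm on $\mathbb{R}^n$ and $x\cdot y$ is the standard inner product. $N_n(\mu,\sigma^2 I_n)$ denotes the $n$-dimensional Gaussian distribution with mean vector $\mu$ and covariance matrix $\sigma^2 I_n$, where $I_n$ is the $n\times n$ identity matrix. The dual norm of a norm $K$ on $\mathbb{R}^n$ is $K^\circ(x)=\sup_{y\ne 0}\frac{x\cdot y}{K(y)}$. *)

(* Defs.v *)
From HB Require Import structures.
From mathcomp Require Import all_boot all_order all_algebra.
From mathcomp Require Import all_classical all_reals all_analysis.

Set Implicit Arguments.
Unset Strict Implicit.
Unset Printing Implicit Defensive.

Import Order.TTheory GRing.Theory Num.Theory.
Import numFieldNormedType.Exports.

Local Open Scope classical_set_scope.
Local Open Scope ring_scope.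

Section EuclideanSpace.
Context {R : realType} {n : nat}.
Implicit Types (K : 'rV[R]_n -> R) (x y v : 'rV[R]_n).

Definition dotv x y : R := \sum_(i < n) x 0 i * y 0 i.

(* The canonical norm `|x| on 'rV[R]_n is the sup norm, hence this one. *)
Definition enorm x : R := Num.sqrt (dotv x x).

Record is_norm K : Prop := IsNorm {
  is_norm_ge0 : forall x, 0 <= K x;
  is_norm_eq0 : forall x, K x = 0 -> x = 0;
  is_normZ : forall (c : R) x, K (c *: x) = `|c| * K x;
  is_normD : forall x y, K (x + y) <= K x + K y }.

Definition dual_norm K x : R :=
  sup [set dotv x y / K y | y in [set y | y != 0]].

Definition dual_ball_radius K : R :=
  sup [set enorm v | v in [set v | dual_norm K v <= 1]].

End EuclideanSpace.

(* N(m, v), parametrized by the variance v. The zero-variance case must be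
   treated apart, because normal_prob m 0 is not the Dirac mass at m but the
   uniform distribution on [0, 1]. *)
Definition gaussian1 {R : realType} (m v : R) : set R -> \bar R :=
  if v == 0 then dirac m else normal_prob m (Num.sqrt v).

(* X ~ N_n(mu, v I_n): the law of X is the product of the N(mu_i, v), an
   equality of probability measures on R^n that is tested on boxes.
   Measurability of X for the Borel sigma-algebra of R^n amounts to that of
   its coordinates. *)
Definition gaussian_vector {d : measure_display} {T : measurableType d}
    {R : realType} {n : nat} (P : probability T R) (X : T -> 'rV[R]_n)
    (mu : 'rV[R]_n) (v : R) : Prop :=
  (forall i : 'I_n, measurable_fun [set: T] (fun w => X w 0 i)) /\
  (forall A : 'I_n -> set R, (forall i, measurable (A i)) ->
    P [set w | forall i, A i (X w 0 i)] =
    (\prod_(i < n) gaussian1 (mu 0%R i) v (A i))%E).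

(* (E |X|^k)^(1/k), as an extended real, for a nonnegative X *)
Definition moment_root {d : measure_display} {T : measurableType d}
    {R : realType} (P : probability T R) (X : T -> R) (k : nat) : \bar R :=
  poweR 'E_P[fun w => X w ^+ k] (k%:R^-1).

(* Main.v *)
(** The proof replaces Santalo-type volume inequalities by a weighted Prekopa-Leindler
    inequality [(E p(Z))^k (E q(Z))^e <= c s^(-n e)] for a standard Gaussian vector [Z], under
    [p(y)^k q(x)^e <= c exp ((k |y|^2 + e |x|^2 - |k y + e s x|^2) / 2)] with [k + e = 1].
    In dimension one, the middle function is a Gaussian density, whose superlevel sets are
    intervals, so that the measure of a combination of two sets is controlled by their
    diameters; Fubini gives the general case.

    With [D] the dual norm of [K] and [M = E D(Z)^2], the choice [e = s^-2],
    [p(y) = exp (- e (D(y)^2 / c - |y|^2) / 2)], [q(x) = exp (- (s^2 - 1) c K(x)^2 / 2)]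
    and the inequality [x . y <= D(x) K(y)] bound the Laplace transform of [K(Z)^2] by the one
    of a multiple of [|Z|^2]; integrating it yields [E K(Z)^-2 <= M / (n (n - 2))] and
    [E K(Z)^-4 <= M^2 / (n^2 (n - 2) (n - 4))].  The choice [k = e = 1/2], [s = 1] bounds the
    exponential moments of a centred Lipschitz function of [Z].

    Then [K(Y) - sigma K(Z) = m + G] with [m] constant, [|m| <= K(mu)] and [E G = 0], where [G]
    has second and fourth moments of order [b = sigma^2 a^2] and [b^2].  Since [G] is centred,
    [E (m + G)^4 <= (m^2 + 32 sqrt 2 b)^2], and for [n >= 6] the
    Cauchy-Schwarz inequality concludes together with [M^2 <= E D(Z)^4]. *)
Require Import Defs.
From mathcomp Require Import all_boot all_order all_algebra.
From mathcomp Require Import all_classical all_reals all_analysis.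
From mathcomp Require Import measurable_realfun ring lra.
Import Order.TTheory GRing.Theory Num.Theory.
Import numFieldNormedType.Exports.
Local Open Scope classical_set_scope.
Local Open Scope ring_scope.
Set Implicit Arguments.
Unset Strict Implicit.
Unset Printing Implicit Defensive.

(** * The Prekopa-Leindler inequality *)

(** The joint law of [Y] and [Z] is arbitrary, so numerator and denominator can only be separated by
    the Cauchy-Schwarz inequality. This calls for [E K(Z)^-4], which is finite only when [n > 4].
    The target has constant one in front of [K(mu)^2 m_2^2], and this constrains both factors. In
    the numerator, [(m + G)^2 <= 2 m^2 + 2 G^2] would already be too lossy. In [E (m + G)^4] a
    surviving term [4 m^3 E G], of order [m^3 sqrt b], would not fit below [(m^2 + C b)^2] when [b]
    is small, which is why [G] has to be centred. In the denominator the inverse moments must be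
    sharp, and they are: for the Euclidean norm the Laplace bound is an equality. The loss of the
    Cauchy-Schwarz inequality in the first term is paid for by the gap between [n^2 (n - 2) (n - 4)]
    and [(n - 2)^4], which has the right sign only from dimension 6 on. *)

Section density.
Context {d} {T : measurableType d} {R : realType}.
Variables (mu nu : {measure set T -> \bar R}) (h : T -> R).
Hypotheses (mh : measurable_fun setT h) (h0 : forall x, 0 <= h x).
Hypothesis nuE : forall A, measurable A -> nu A = (\int[mu]_(x in A) (h x)%:E)%E.

Import HBNNSimple.

Let integral_density_nnsfun (f : {nnsfun T >-> R}) :
  (\int[nu]_x (f x)%:E = \int[mu]_x ((f x)%:E * (h x)%:E))%E.
Proof.
under [LHS]eq_integral do rewrite fimfunE -fsumEFin//.
rewrite [LHS]ge0_integral_fsum//; last 2 first.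
  - by move=> r; exact/measurable_EFinP/measurableT_comp.
  - by move=> n x _; rewrite EFinM nnfun_muleindic_ge0.
under [RHS]eq_integral.
  move=> x xD; rewrite fimfunE -fsumEFin// ge0_mule_fsuml; last first.
    by move=> r; rewrite EFinM nnfun_muleindic_ge0.
  over.
rewrite [RHS]ge0_integral_fsum//; last 2 first.
  - by move=> r; apply: emeasurable_funM; apply/measurable_EFinP => //; exact/measurableT_comp.
  - by move=> n x _; rewrite mule_ge0//; [rewrite EFinM nnfun_muleindic_ge0|rewrite lee_fin].
apply: eq_fsbigr => r _.
rewrite integralZl_indic_nnsfun// integral_indic//= setIT nuE//.
under [RHS]eq_integral do rewrite EFinM -muleA.
have [r0|r0] := leP 0 r.
  rewrite ge0_integralZl//.
  - congr (_ * _)%E; rewrite integral_mkcond/=; apply: eq_integral => x _.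
    rewrite patchE indicE; case: ifPn => _; first by rewrite mul1e.
    by rewrite mul0e.
  - by apply: emeasurable_funM; apply/measurable_EFinP => //; exact: measurable_indic.
  - by move=> x _; rewrite mule_ge0// lee_fin.
have fr : f @^-1` [set r] = set0.
  apply/seteqP; split => x //= xr; move: r0.
  by rewrite -xr ltNge => /negP; apply; exact: fun_ge0.
rewrite fr integral_set0 mule0.
by apply/esym/integral0_eq => x _; rewrite indic0 mul0e mule0.
Qed.

Lemma ge0_integral_density (f : T -> \bar R) : measurable_fun setT f ->
  (forall x, 0 <= f x)%E ->
  (\int[nu]_x f x = \int[mu]_x (f x * (h x)%:E))%E.
Proof.
move=> mf f0.
pose f_ := nnsfun_approx measurableT mf.
transitivity (lim (\int[nu]_x (f_ n x)%:E @[n --> \oo])%E).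
  rewrite -monotone_convergence//=.
  - apply: eq_integral => ? /[!inE] xD; apply/esym/cvg_lim => //=.
    exact: cvg_nnsfun_approx.
  - by move=> n; exact/measurable_EFinP/measurable_funTS.
  - by move=> n ? _; rewrite lee_fin.
  - by move=> ? _ ? ? mn; rewrite lee_fin; exact/lefP/nd_nnsfun_approx.
transitivity (lim (\int[mu]_x ((f_ n x)%:E * (h x)%:E) @[n --> \oo])%E).
  by apply: congr_lim; apply/funext => n /=; exact: integral_density_nnsfun.
rewrite -monotone_convergence//=.
- apply: eq_integral => x _; apply/cvg_lim => //=.
  by apply: cvgeZr => //; exact: cvg_nnsfun_approx.
- by move=> n; apply: emeasurable_funM; apply/measurable_EFinP.
- by move=> n x _; rewrite mule_ge0// lee_fin.
- move=> x _ m n mn; rewrite lee_pmul// ?lee_fin//; exact/lefP/nd_nnsfun_approx.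
Qed.
End density.

(** * Lengths of superlevel sets on the line *)

Section layers.
Context {R : realType}.
Notation leb := (@lebesgue_measure R).

(* Tonelli on the region under the graph of [f], cut at height [1]. *)
Lemma integral_superlevel (f : R -> R) : measurable_fun setT f -> (forall x, 0 <= f x) ->
  (\int[leb]_(t in `[0%R, 1%R]) leb [set x | (t < f x)%R] =
   \int[leb]_x (Num.min (f x) 1)%:E)%E.
Proof.
move=> mf f0.
pose A : set (R * R) := [set z | 0 <= z.1 <= 1] `&` [set z | z.1 < f z.2].
have mfs : measurable_fun setT (f \o @snd R R) by exact: measurableT_comp.
have mA : measurable A.
  apply: measurableI.
    rewrite (_ : [set z | _] = `[0%R, 1%R] `*` setT); first exact: measurableX.
    by apply/seteqP; split=> -[x y] /=; rewrite in_itv/=; tauto.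
  rewrite (_ : [set z | _] = setT `&` (fun z : R * R => f z.2 - z.1) @^-1` `]0, +oo[).
    by have /(_ measurableT) := measurable_funB mfs (@measurable_fst _ _ R R); exact.
  by rewrite setTI; apply/seteqP; split=> z /=; rewrite in_itv/= andbT subr_gt0.
have := @product_measure_unique _ _ _ _ R leb leb (leb \x^ leb)%E
  (fun A B mA mB => product_measure2E leb leb mA mB) A mA.
rewrite /product_measure1 /product_measure2 /= => E.
transitivity (\int[leb]_x (leb \o xsection A) x)%E.
  rewrite integral_mkcond; apply: eq_integral => t _ /=.
  rewrite patchE; case: ifPn => tin.
    congr leb; apply/seteqP; split => x /=; rewrite /xsection/= inE /A/=.
      by move: tin; rewrite inE/= in_itv/= => ->.
    by case.
  rewrite (_ : xsection _ _ = set0) ?measure0//; apply/seteqP; split => x //=.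
  rewrite /xsection/= inE => -[/= tt _]; move: tin; rewrite notin_setE/= in_itv/=.
  by rewrite tt.
rewrite E; apply: eq_integral => x _ /=.
set m := Num.min (f x) 1.
have m0 : 0 <= m by rewrite /m le_min f0 ler01.
apply/eqP; rewrite eq_le; apply/andP; split.
  apply: (@le_trans _ _ (leb `[0, m])); last first.
    by rewrite lebesgue_measure_itv/= lte_fin oppr0 adde0; case: ifPn => //; rewrite lee_fin.
  apply: le_measure; rewrite ?inE//.
    exact: measurable_ysection.
  move=> t; rewrite /ysection/= inE => -[/= /andP[t0 t1] tf].
  by rewrite in_itv/= t0 /= /m le_min t1 (ltW tf).
apply: (@le_trans _ _ (leb `[0, m[)).
  rewrite lebesgue_measure_itv/= lte_fin oppr0 adde0; case: ifPn => //.
  by rewrite -leNgt lee_fin.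
apply: le_measure; rewrite ?inE//.
  exact: measurable_ysection.
move=> t; rewrite /= in_itv/= => /andP[t0]; rewrite /m lt_min => /andP[tf t1].
by rewrite /ysection/= inE/A/= t0 (ltW t1).
Qed.

Lemma lebesgue_measure_bounded_le (A : set R) (a b : R) : measurable A -> A !=set0 ->
  (forall x, A x -> a <= x <= b) -> (leb A <= (b - a)%:E)%E.
Proof.
move=> mA [x0 Ax0] Aab.
have ab : a <= b by have /andP[] := Aab _ Ax0; exact: le_trans.
apply: (@le_trans _ _ (leb `[a, b])); last first.
  rewrite lebesgue_measure_itv/= lte_fin; case: ifPn => //.
  by rewrite lee_fin subr_ge0.
by apply: le_measure; rewrite ?inE// => x /Aab/=; rewrite in_itv.
Qed.

(** The set [k A + l B] lies in [[- M / 2, M / 2]], so comparing extreme points is enough: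
    [k sup A + l sup B <= M / 2] and [- M / 2 <= k inf A + l inf B], while the length of a set is at
    most the distance between its bounds. This stands in for the one-dimensional Brunn-Minkowski
    inequality. *)
Lemma lebesgue_measure_combination (k l : R) (A B : set R) (M : \bar R) : 0 < k -> 0 < l ->
  measurable A -> measurable B -> A !=set0 -> B !=set0 ->
  (forall y x, A y -> B x -> ((2 * `|k * y + l * x|)%:E <= M)%E) ->
  (k%:E * leb A + l%:E * leb B <= M)%E.
Proof.
move=> k0 l0 mA mB A0 B0 AB.
case: M AB => [m||] AB; last 2 first.
- by rewrite leey.
- by have [[y Ay] [x Bx]] := (A0, B0); have := AB _ _ Ay Bx.
have {}AB y x : A y -> B x -> `|k * y + l * x| <= m / 2.
  by move=> Ay /(AB _ _ Ay); rewrite lee_fin; lra.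
have [y0 Ay0] := A0; have [x0 Bx0] := B0.
have sA : has_sup A.
  split => //; exists ((m / 2 - l * x0) / k) => y /AB /(_ Bx0).
  by rewrite ler_norml => /andP[? ?]; rewrite ler_pdivlMr//; lra.
have iA : has_inf A.
  split => //; exists ((- (m / 2) - l * x0) / k) => y /AB /(_ Bx0).
  by rewrite ler_norml => /andP[? ?]; rewrite ler_pdivrMr//; lra.
have sB : has_sup B.
  split => //; exists ((m / 2 - k * y0) / l) => x /(AB _ _ Ay0).
  by rewrite ler_norml => /andP[? ?]; rewrite ler_pdivlMr//; lra.
have iB : has_inf B.
  split => //; exists ((- (m / 2) - k * y0) / l) => x /(AB _ _ Ay0).
  by rewrite ler_norml => /andP[? ?]; rewrite ler_pdivrMr//; lra.
have supAB : k * sup A + l * sup B <= m / 2.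
  suff : sup B <= (m / 2 - k * sup A) / l by rewrite ler_pdivlMr//; lra.
  apply: ge_sup => // x Bx; rewrite ler_pdivlMr//.
  suff : sup A <= (m / 2 - l * x) / k by rewrite ler_pdivlMr//; lra.
  apply: ge_sup => // y Ay; rewrite ler_pdivlMr//.
  by have := AB _ _ Ay Bx; rewrite ler_norml => /andP[]; lra.
have infAB : - (m / 2) <= k * inf A + l * inf B.
  suff : (- (m / 2) - k * inf A) / l <= inf B by rewrite ler_pdivrMr//; lra.
  apply: lb_le_inf => // x Bx; rewrite ler_pdivrMr//.
  suff : (- (m / 2) - l * x) / k <= inf A by rewrite ler_pdivrMr//; lra.
  apply: lb_le_inf => // y Ay; rewrite ler_pdivrMr//.
  by have := AB _ _ Ay Bx; rewrite ler_norml => /andP[]; lra.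
have lA : (leb A <= (sup A - inf A)%:E)%E.
  apply: lebesgue_measure_bounded_le => // x Ax.
  by rewrite ge_inf//= ?ub_le_sup//; [case: sA|case: iA].
have lB : (leb B <= (sup B - inf B)%:E)%E.
  apply: lebesgue_measure_bounded_le => // x Bx.
  by rewrite ge_inf//= ?ub_le_sup//; [case: sB|case: iB].
apply: (@le_trans _ _ (k%:E * (sup A - inf A)%:E + l%:E * (sup B - inf B)%:E)%E).
  by apply: leeD; rewrite lee_pmul2l ?lte_fin.
by rewrite -!EFinM -EFinD lee_fin; lra.
Qed.
End layers.

(** * The inequality on the line, for an even and unimodal middle function *)

Section prekopa_leindler1.
Context {R : realType}.
Notation leb := (@lebesgue_measure R).

Lemma measurable_lebesgue_superlevel (f : R -> R) : measurable_fun setT f ->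
  measurable_fun setT (fun t : R => leb [set x | (t < f x)%R]).
Proof.
move=> mf.
have mfs : measurable_fun setT (f \o @snd R R) by exact: measurableT_comp.
pose A : set (R * R) := [set z | z.1 < f z.2].
have mA : measurable A.
  rewrite (_ : A = setT `&` (fun z : R * R => f z.2 - z.1) @^-1` `]0, +oo[).
    by have /(_ measurableT) := measurable_funB mfs (@measurable_fst _ _ R R); exact.
  by rewrite setTI; apply/seteqP; split=> z /=; rewrite in_itv/= andbT subr_gt0.
rewrite (_ : (fun t => _) = leb \o xsection A).
  exact: measurable_fun_xsection.
by apply/funext => t /=; congr leb; apply/seteqP; split => x; rewrite /xsection/= inE.
Qed.

Lemma weighted_AGM (k e a b : R) : 0 < k -> 0 < e -> k + e = 1 -> 0 <= a -> 0 <= b ->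
  a `^ k * b `^ e <= k * a + e * b.
Proof.
move=> k0 e0 ke a0 b0.
have := @conjugate_powR R (a `^ k) (b `^ e) k^-1 e^-1 (powR_ge0 _ _) (powR_ge0 _ _).
rewrite !invr_gt0 !invrK => /(_ k0 e0 ke).
by rewrite -!powRrM !divff ?gt_eqF// !powRr1// (mulrC k) (mulrC e).
Qed.

(* Dividing [p] and [q] by their suprema makes all their superlevel sets at heights in [0, 1)
   nonempty, which the additivity of lengths requires. *)
Lemma prekopa_leindler1 (k e s : R) (p q g : R -> R) :
  0 < k -> 0 < e -> k + e = 1 -> 0 < s ->
  measurable_fun setT p -> measurable_fun setT q -> measurable_fun setT g ->
  (forall x, 0 <= p x) -> (forall x, 0 <= q x) -> (forall x, 0 <= g x) ->
  (forall x y, `|x| <= `|y| -> g y <= g x) ->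
  (forall y x, p y `^ k * q x `^ e <= g (k * y + e * s * x)) ->
  ((\int[leb]_x (p x)%:E) `^ k * (\int[leb]_x (q x)%:E) `^ e <=
   (s `^ (- e))%:E * \int[leb]_x (g x)%:E)%E.
Proof.
move=> k0 e0 ke s0 mp mq mg p0 q0 g0 gdec pqg.
have se0 : 0 < s `^ (- e) by rewrite powR_gt0.
have rhs0 : (0 <= (s `^ (- e))%:E * \int[leb]_x (g x)%:E)%E.
  by rewrite mule_ge0 ?lee_fin ?(ltW se0)//; apply: integral_ge0 => x _; rewrite lee_fin.
have int0 (f : R -> R) : (forall x, 0 <= f x) -> ~ (exists x, 0 < f x) ->
    (\int[leb]_x (f x)%:E = 0)%E.
  move=> f0 nf; apply: integral0_eq => x _.
  congr (_%:E); apply/eqP; rewrite eq_le f0 andbT leNgt; apply/negP => fx.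
  by apply: nf; exists x.
have [[y0 py0]|/int0 ->//] := pselect (exists y, 0 < p y); last first.
  by rewrite poweR0r ?gt_eqF// mul0e.
have [[x0 qx0]|/int0 ->//] := pselect (exists x, 0 < q x); last first.
  by rewrite (@poweR0r _ e) ?gt_eqF// mule0.
have powRKV (l a : R) : 0 < l -> 0 <= a -> (a `^ l) `^ l^-1 = a.
  by move=> l0 a0; rewrite -powRrM divff ?gt_eqF// powRr1.
have gle z : g z <= g 0 by apply: gdec; rewrite normr0.
(* As [g] is bounded by [g 0], one point where [q] is positive bounds [p], and conversely. *)
have supp : has_sup (range p).
  split; first by exists (p y0), y0.
  exists ((g 0 / q x0 `^ e) `^ k^-1) => _ [y _ <-].
  rewrite -[leLHS](powRKV k)//; apply: ge0_ler_powR => //.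
  - by rewrite invr_ge0 ltW.
  - by rewrite nnegrE powR_ge0.
  - by rewrite nnegrE divr_ge0 ?powR_ge0.
  - by rewrite ler_pdivlMr ?powR_gt0//; exact: le_trans (pqg _ _) _.
have supq : has_sup (range q).
  split; first by exists (q x0), x0.
  exists ((g 0 / p y0 `^ k) `^ e^-1) => _ [x _ <-].
  rewrite -[leLHS](powRKV e)//; apply: ge0_ler_powR => //.
  - by rewrite invr_ge0 ltW.
  - by rewrite nnegrE powR_ge0.
  - by rewrite nnegrE divr_ge0 ?powR_ge0.
  - by rewrite ler_pdivlMr ?powR_gt0// mulrC; exact: le_trans (pqg _ _) _.
set al := sup (range p); set be := sup (range q).
have pal y : p y <= al by apply: ub_le_sup; [case: supp|exists y].
have qbe x : q x <= be by apply: ub_le_sup; [case: supq|exists x].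
have al0 : 0 < al := lt_le_trans py0 (pal _).
have be0 : 0 < be := lt_le_trans qx0 (qbe _).
pose th := al `^ k * be `^ e.
have th0 : 0 < th by rewrite mulr_gt0 ?powR_gt0.
have mdiv (f : R -> R) c : measurable_fun setT f -> measurable_fun setT (fun x => f x / c).
  by move=> mf; exact: measurable_funM.
pose A t := [set y | (t < p y / al)%R]; pose B t := [set y | (t < q y / be)%R].
pose L t := [set y | (t < g y / th)%R].
have mS (f : R -> R) t : measurable_fun setT f -> measurable [set x | t < f x].
  move=> mf; rewrite (_ : [set _ | _] = setT `&` f @^-1` `]t, +oo[).
    by apply: mf.
  by rewrite setTI; apply/seteqP; split => x /=; rewrite in_itv/= andbT.
(* Both functions are cut at the same relative height [t]; the matching height for [g] is [t * th],
   because [k + e = 1]. At [t = 1] the sets [A t] and [B t] are empty, and below it they are not. *)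
have key t : 0 <= t <= 1 ->
    (k%:E * leb (A t) + (e * s)%:E * leb (B t) <= leb (L t))%E.
  move=> /andP[t0]; rewrite le_eqVlt => /predU1P[->|t1].
    have -> : A 1 = set0.
      apply/seteqP; split => y //=.
      by rewrite /A/= ltr_pdivlMr// mul1r ltNge pal.
    have -> : B 1 = set0.
      apply/seteqP; split => y //=.
      by rewrite /B/= ltr_pdivlMr// mul1r ltNge qbe.
    by rewrite measure0 !mule0 adde0 measure_ge0.
  have sup_lt (f : R -> R) : has_sup (range f) -> 0 < sup (range f) ->
      [set y | t < f y / sup (range f)] !=set0.
    move=> fs f0; have : t * sup (range f) < sup (range f) by rewrite gtr_pMl.
    by move=> /(sup_gt fs.1)[_ [y _ <-] ty]; exists y => /=; rewrite ltr_pdivlMr.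
  apply: lebesgue_measure_combination => //.
  - by rewrite mulr_gt0.
  - by apply: mS; exact: mdiv.
  - by apply: mS; exact: mdiv.
  - exact: sup_lt.
  - exact: sup_lt.
  move=> y x; rewrite /A /B /= !ltr_pdivlMr// => ty tx.
  set z := k * y + e * s * x.
  have zL : t * th < g z.
    apply: lt_le_trans (pqg y x).
    rewrite (_ : t * th = (t * al) `^ k * (t * be) `^ e); last first.
      rewrite !powRM// ?(ltW al0) ?(ltW be0)// mulrACA -powRD ?ke ?powRr1//.
      by rewrite gt_eqF.
    apply: ltr_pM; rewrite ?powR_ge0//; apply: gt0_ltr_powR => //; rewrite nnegrE//.
      by rewrite mulr_ge0// ltW.
    by rewrite mulr_ge0// ltW.
  (* By monotonicity in the absolute value, the superlevel set of [g] contains this whole interval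
     as soon as it contains [z]; its length is the [2 * |z|] of the combination lemma. *)
  apply: (@le_trans _ _ (leb `[- `|z|, `|z|])).
    rewrite lebesgue_measure_itv/= lte_fin.
    case: ltP => [_|]; first by rewrite -EFinD lee_fin; lra.
    by rewrite lee_fin; have := normr_ge0 z; lra.
  apply: le_measure; rewrite ?inE//.
    by apply: mS; exact: mdiv.
  move=> w /=; rewrite in_itv/= -ler_norml => /gdec gzw.
  by rewrite /L/= ltr_pdivlMr//; exact: lt_le_trans gzw.
have mA (f : R -> R) (c : R) : measurable_fun setT f ->
    measurable_fun (`[0, 1]%classic : set R) (fun t : R => leb [set x | (t < f x / c)%R]).
  by move=> mf; apply: measurable_funTS; apply: measurable_lebesgue_superlevel; exact: mdiv.
have es0 : 0 < e * s by rewrite mulr_gt0.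
have : (\int[leb]_(t in `[0%R, 1%R]) (k%:E * leb (A t) + (e * s)%:E * leb (B t)) <=
        \int[leb]_(t in `[0%R, 1%R]) leb (L t))%E.
  apply: ge0_le_integral => //.
  - by move=> t _; rewrite adde_ge0// mule_ge0// lee_fin ltW.
  - by apply: emeasurable_funD; apply: emeasurable_funM => //; exact: mA.
  - exact: mA.
rewrite ge0_integralD//=; last 4 first.
- by move=> t _; rewrite mule_ge0// lee_fin ltW.
- by apply: emeasurable_funM => //; exact: mA.
- by move=> t _; rewrite mule_ge0// lee_fin ltW.
- by apply: emeasurable_funM => //; exact: mA.
rewrite !ge0_integralZl//; [|exact: mA|by rewrite lee_fin ltW|exact: mA|by rewrite lee_fin ltW].
have div0 (f : R -> R) c : (forall x, 0 <= f x) -> 0 < c -> forall x, 0 <= f x / c.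
  by move=> f0 c0 x; rewrite divr_ge0// ltW.
rewrite !integral_superlevel; [|exact: mdiv|exact: div0|exact: mdiv|exact: div0|exact: mdiv|
  exact: div0].
have intdiv (f : R -> R) c : measurable_fun setT f -> (forall x, 0 <= f x) -> 0 < c ->
    (forall x, f x <= c) ->
    (\int[leb]_x (Num.min (f x / c) 1)%:E = c^-1%:E * \int[leb]_x (f x)%:E)%E.
  move=> mf f0 c0 fc; rewrite -ge0_integralZl//; last 3 first.
  - exact/measurable_EFinP.
  - by move=> x _; rewrite lee_fin.
  - by rewrite lee_fin invr_ge0 ltW.
  apply: eq_integral => x _; rewrite min_l; first by rewrite mulrC EFinM.
  by rewrite ler_pdivrMr// mul1r.
rewrite (intdiv p al)// (intdiv q be)//.
set I := (\int[leb]_x (p x)%:E)%E; set J := (\int[leb]_x (q x)%:E)%E.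
set M := (\int[leb]_x (g x)%:E)%E => IJM.
have {IJM} : (k%:E * (al^-1%:E * I) + (e * s)%:E * (be^-1%:E * J) <= th^-1%:E * M)%E.
  apply: (le_trans IJM); rewrite -ge0_integralZl//; last 3 first.
  - exact/measurable_EFinP.
  - by move=> x _; rewrite lee_fin.
  - by rewrite lee_fin invr_ge0 ltW.
  apply: ge0_le_integral => //.
  - by move=> x _; rewrite lee_fin le_min ler01 divr_ge0// ltW.
  - by apply/measurable_EFinP; apply: measurable_minr => //; exact: mdiv.
  - by apply: emeasurable_funM => //; exact/measurable_EFinP.
  - by move=> x _; rewrite -EFinM lee_fin ge_min mulrC lexx.
have I0 : (0 <= I)%E by apply: integral_ge0 => x _; rewrite lee_fin.
have J0 : (0 <= J)%E by apply: integral_ge0 => x _; rewrite lee_fin.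
have M0 : (0 <= M)%E by apply: integral_ge0 => x _; rewrite lee_fin.
case: M M0 {rhs0} => [m m0|_|//]; last by move=> _; rewrite gt0_muley ?lte_fin// leey.
have kal : 0 < k * al^-1 by rewrite mulr_gt0 ?invr_gt0.
have ebe : 0 < e * s * be^-1 by rewrite mulr_gt0 ?invr_gt0.
have kali : 0 < al^-1 by rewrite invr_gt0.
have bei : 0 < be^-1 by rewrite invr_gt0.
case: I I0 => [i i0|_|//]; case: J J0 => [j j0|_|//]; last 3 first.
- by rewrite gt0_muley ?lte_fin// gt0_muley ?lte_fin// addye.
- by rewrite ?(gt0_muley, lte_fin)//.
- by rewrite ?(gt0_muley, lte_fin)//.
rewrite -!EFinM -EFinD !lee_fin => ijm.
move: i0 j0 m0; rewrite !lee_fin => i0 j0 m0.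
(* The factor [s] stays with [j / be]: the mean inequality turns it into [s ^ e], whence the
   [s ^ (- e)] of the conclusion. *)
have := @weighted_AGM k e (i / al) (s * (j / be)) k0 e0 ke.
rewrite divr_ge0 ?(ltW al0)// mulr_ge0 ?divr_ge0 ?(ltW be0) ?(ltW s0)// => /(_ isT isT) agm.
have {agm} : (i / al) `^ k * (s * (j / be)) `^ e <= th^-1 * m.
  by apply: le_trans agm (le_trans _ ijm); rewrite le_eqVlt; apply/orP; left; apply/eqP; ring.
rewrite powRM ?(ltW s0) ?divr_ge0 ?(ltW be0)// !powRM ?invr_ge0 ?(ltW al0) ?(ltW be0)//.
have invP (a l : R) : 0 <= a -> a^-1 `^ l = (a `^ l)^-1.
  by move=> a0; rewrite -powR_inv1// powRAC powR_inv1 ?powR_ge0.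
rewrite !invP ?(ltW al0) ?(ltW be0)// powRN /th.
have := powR_gt0 k al0; have := powR_gt0 e be0; have := powR_gt0 e s0.
set a := al `^ k; set b := be `^ e; set c := s `^ e; set x := i `^ k; set y := j `^ e.
move=> c0 b0 a0.
rewrite (_ : x / a * (c * (y / b)) = (x * y) * (c / (a * b))); last by field; rewrite !gt_eqF.
have cab0 : 0 < c / (a * b) by rewrite divr_gt0 ?mulr_gt0.
rewrite mulrC -ler_pdivlMl//.
suff -> : (c / (a * b))^-1 * ((a * b)^-1 * m) = c^-1 * m by [].
by field; rewrite !gt_eqF.
Qed.
End prekopa_leindler1.

Section boxes.
Context {R : realType}.

Lemma tuple_measure_unique n (m1 m2 : {measure set (n.-tuple R) -> \bar R}) :
  (m1 setT < +oo)%E ->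
  (forall A : 'I_n -> set R, (forall i, measurable (A i)) ->
    m1 [set t | forall i, A i (tnth t i)] = m2 [set t | forall i, A i (tnth t i)]) ->
  forall B, measurable B -> m1 B = m2 B.
Proof.
move=> m1y m12 B mB.
pose G := [set B | exists2 A : 'I_n -> set R, (forall i, measurable (A i)) &
  B = [set t : n.-tuple R | forall i, A i (tnth t i)]].
have mtnth A i : measurable A -> measurable [set t : n.-tuple R | A (tnth t i)].
  by move=> mA; have := @measurable_tnth _ R n i measurableT A mA; rewrite setTI.
apply: (g_sigma_algebra_measure_unique G _ (fun=> setT)) => //.
- move=> _ [A mA ->].
  rewrite (_ : [set t | _] = \big[setI/setT]_(i < n) [set t : n.-tuple R | A i (tnth t i)]).
    by apply: bigsetI_measurable => i _; exact: mtnth.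
  apply/seteqP; split => t /=; first by move=> tA; rewrite -bigcap_seq => i _; exact: tA.
  by rewrite -bigcap_seq => tA i; apply: tA; rewrite /= mem_index_enum.
- by move=> _; exists (fun=> setT) => //; apply/seteqP.
- by rewrite bigcup_const//; exists 0%N.
- move=> _ _ [A1 mA1 ->] [A2 mA2 ->]; exists (fun i => A1 i `&` A2 i).
    by move=> i; exact: measurableI.
  by apply/seteqP; split=> t /=; [move=> [? ?] i|move=> tA; split=> i; case: (tA i)].
- by move=> _ [A mA ->]; exact: m12.
move: B mB; apply: smallest_sub; first exact: (@smallest_sigma_algebra _ setT G).
move=> A; rewrite -bigcup_seq => -[i _ [B mB <-]].
apply: sub_sigma_algebra; exists (fun j => if j == i then B else setT).
  by move=> j; case: ifP.
rewrite setTI; apply/seteqP; split => t /=.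
  by move=> tB j; case: eqP => // ->.
by move=> /(_ i); rewrite eqxx.
Qed.
End boxes.

(** * The inequality for the standard normal law on the line *)

Section gauss_pl.
Context {R : realType}.
Notation leb := (@lebesgue_measure R).
Notation gam := (normal_prob (0 : R) 1).

Lemma ge0_integral_normal (f : R -> \bar R) : measurable_fun setT f ->
  (forall x, 0 <= f x)%E ->
  (\int[gam]_x f x = \int[leb]_x (f x * (normal_pdf 0 1 x)%:E))%E.
Proof.
move=> mf f0; apply: ge0_integral_density => //.
- exact: measurable_normal_pdf.
- by move=> x; exact: normal_pdf_ge0.
Qed.

Lemma normal_pdf01E (x : R) : normal_pdf 0 1 x = normal_peak 1 * expR (- (x ^+ 2 / 2)).
Proof.
rewrite normal_pdfE ?oner_eq0// /normal_fun subr0 expr1n; congr (_ * expR _).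
by rewrite mulNr.
Qed.

(** With [phi] the standard normal density and [k + e = 1], this is the exponent for which
    [phi(y)^k phi(x)^e] times its exponential equals [phi(k y + e s x)]. *)
Definition gauss_gap (k e s y x : R) : R :=
  (k * y ^+ 2 + e * x ^+ 2 - (k * y + e * s * x) ^+ 2) / 2.

Lemma powR_expR (x l : R) : expR x `^ l = expR (l * x).
Proof. by rewrite /powR gt_eqF ?expR_gt0// expRK. Qed.

(** The Lebesgue version is applied to [p phi], [q phi] and [c phi]. Infinite values are allowed
    because [p] and [q] become partial integrals in the induction on the dimension. *)
Lemma gauss_prekopa_leindler1 (k e s c : R) (p q : R -> \bar R) :
  0 < k -> 0 < e -> k + e = 1 -> 0 < s -> 0 <= c ->
  measurable_fun setT p -> measurable_fun setT q ->
  (forall x, 0 <= p x)%E -> (forall x, 0 <= q x)%E ->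
  (forall y x, p y `^ k * q x `^ e <= (c * expR (gauss_gap k e s y x))%:E)%E ->
  ((\int[gam]_x p x) `^ k * (\int[gam]_x q x) `^ e <= (c * s `^ (- e))%:E)%E.
Proof.
move=> k0 e0 ke s0 c0 mp mq p0 q0 pqc.
have rhs0 : (0 <= (c * s `^ (- e))%:E)%E by rewrite lee_fin mulr_ge0 ?powR_ge0.
(* If one function is infinite at a point, the finite bound forces the other to vanish
   everywhere. *)
have [[y py]|pfin] := pselect (exists y, p y = +oo%E).
  suff -> : (\int[gam]_x q x = 0)%E by rewrite (poweR0r (lt0r_neq0 e0)) mule0.
  apply: integral0_eq => x _; apply/eqP; rewrite eq_le q0 andbT leNgt; apply/negP => qx.
  have := pqc y x; rewrite py poweRyr ?gt_eqF// gt0_mulye ?poweR_gt0//.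
have [[x qx]|qfin] := pselect (exists x, q x = +oo%E).
  suff -> : (\int[gam]_x p x = 0)%E by rewrite (poweR0r (lt0r_neq0 k0)) mul0e.
  apply: integral0_eq => y _; apply/eqP; rewrite eq_le p0 andbT leNgt; apply/negP => py.
  have := pqc y x; rewrite qx (poweRyr (lt0r_neq0 e0)) gt0_muley ?poweR_gt0//.
have pE y : p y = (fine (p y))%:E.
  rewrite fineK// ge0_fin_numE// ltey; apply/eqP => py; apply: pfin; by exists y.
have qE y : q y = (fine (q y))%:E.
  rewrite fineK// ge0_fin_numE// ltey; apply/eqP => qy; apply: qfin; by exists y.
have fp0 y : 0 <= fine (p y) by rewrite fine_ge0.
have fq0 y : 0 <= fine (q y) by rewrite fine_ge0.
rewrite !ge0_integral_normal//.
pose ph := normal_pdf (0 : R) 1.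
have ph0 x : 0 <= ph x by exact: normal_pdf_ge0.
have mph : measurable_fun setT ph by exact: measurable_normal_pdf.
pose p' y := fine (p y) * ph y; pose q' y := fine (q y) * ph y.
have := @prekopa_leindler1 R k e s p' q' (fun z => c * ph z) k0 e0 ke s0.
rewrite (_ : (\int[leb]_x (p' x)%:E = \int[leb]_x (p x * (ph x)%:E))%E); last first.
  by apply: eq_integral => x _; rewrite EFinM -pE.
rewrite (_ : (\int[leb]_x (q' x)%:E = \int[leb]_x (q x * (ph x)%:E))%E); last first.
  by apply: eq_integral => x _; rewrite EFinM -qE.
rewrite (_ : (\int[leb]_x (c * ph x)%:E = c%:E)%E); last first.
  under eq_integral do rewrite EFinM.
  rewrite ge0_integralZl//; last 2 first.
  - exact/measurable_EFinP.
  - by move=> x _; rewrite lee_fin.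
  by rewrite integral_normal_pdf mule1.
rewrite -EFinM [_ * c]mulrC; apply.
- by apply: measurable_funM => //; exact: measurableT_comp.
- by apply: measurable_funM => //; exact: measurableT_comp.
- exact: measurable_funM.
- by move=> x; rewrite mulr_ge0.
- by move=> x; rewrite mulr_ge0.
- by move=> x; rewrite mulr_ge0.
- move=> x y xy; rewrite ler_wpM2l// /ph !normal_pdf01E ler_wpM2l ?normal_peak_ge0//.
  rewrite ler_expR lerN2 ler_pM2r// -(real_normK (num_real x)) -(real_normK (num_real y)).
  by rewrite lerXn2r ?nnegrE.
move=> y x; rewrite /p' /q' /ph !normal_pdf01E.
set P := normal_peak 1; have P0 : 0 < P by rewrite normal_peak_gt0 ?oner_eq0.
have := pqc y x; rewrite pE qE !poweR_EFin -EFinM lee_fin.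
set a := fine _; set b := fine _ => abc.
rewrite !powRM ?mulr_ge0 ?expR_ge0 ?(ltW P0) ?fp0 ?fq0// !powR_expR.
have PE : P `^ k * P `^ e = P by rewrite -powRD ke ?powRr1 ?(ltW P0)// oner_eq0.
rewrite (_ : _ * _ = a `^ k * b `^ e * (P * expR (k * - (y ^+ 2 / 2) + e * - (x ^+ 2 / 2)))).
  apply: (@le_trans _ _ (c * expR (gauss_gap k e s y x) *
      (P * expR (k * - (y ^+ 2 / 2) + e * - (x ^+ 2 / 2))))).
    by rewrite ler_wpM2r// mulr_ge0 ?expR_ge0 ?(ltW P0).
  rewrite mulrACA -expRD mulrA le_eqVlt; apply/orP; left; apply/eqP; congr (_ * expR _).
  by rewrite /gauss_gap; field.
rewrite -{3}PE expRD; ring.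
Qed.

Section resample.
Context {d} {T : measurableType d} (P : probability T R).

(** Everything is stated on the space [T] that carries [X], so that no product of [n] normal laws
    has to be built. *)
Definition gauss_tuple n (X : T -> n.-tuple R) := measurable_fun setT X /\
  forall A : 'I_n -> set R, (forall i, measurable (A i)) ->
    P [set w | forall i, A i (tnth (X w) i)] = (\prod_(i < n) gam (A i))%E.

Definition tuple_tail n (t : n.+1.-tuple R) : n.-tuple R := [tuple of behead t].

Lemma tnth_tail n (t : n.+1.-tuple R) (i : 'I_n) :
  tnth (tuple_tail t) i = tnth t (lift ord0 i).
Proof. by rewrite [in RHS](tuple_eta t) tnthS. Qed.

Lemma gauss_tuple_tail n (X : T -> n.+1.-tuple R) : gauss_tuple X ->
  gauss_tuple (@tuple_tail n \o X).
Proof.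
move=> [mX XA]; split.
  by apply: (@measurableT_comp _ _ _ _ _ _ (@tuple_tail n)) => //; exact: measurable_behead.
move=> A mA.
pose A' (i : 'I_n.+1) := if unlift ord0 i is Some j then A j else setT.
have mA' i : measurable (A' i) by rewrite /A'; case: unliftP => // j _.
rewrite (_ : [set w | _] = [set w | forall i, A' i (tnth (X w) i)]).
  rewrite XA// big_ord_recl /A' unlift_none probability_setT mul1e.
  by apply: eq_bigr => i _; rewrite liftK.
apply/seteqP; split => w /=.
  by move=> Aw i; rewrite /A'; case: unliftP => // j ->; rewrite -tnth_tail.
by move=> Aw i; have := Aw (lift ord0 i); rewrite /A' liftK tnth_tail.
Qed.

(** The first coordinate is independent of the tail, so exchanging it for a fresh normal variable
    leaves the law of the tuple unchanged: both laws agree on boxes. This is the Fubini step of the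
    induction on the dimension. *)
Lemma gauss_tuple_resample n (X : T -> n.+1.-tuple R) (f : n.+1.-tuple R -> \bar R) :
  gauss_tuple X -> measurable_fun setT f -> (forall t, 0 <= f t)%E ->
  (\int[P]_w f (X w) = \int[gam]_x \int[P]_w f [tuple of x :: tuple_tail (X w)])%E.
Proof.
move=> gX mf f0; have [mX XA] := gX.
have [mtl tlA] := gauss_tuple_tail gX.
pose h (z : measurableTypeR R * T) : n.+1.-tuple R := [tuple of z.1 :: tuple_tail (X z.2)].
have mh : measurable_fun setT h.
  by apply: measurable_cons => //; exact: (measurableT_comp mtl).
pose gP := [the probability (measurableTypeR R * T)%type R of (gam \x P)%E].
pose m1 := distribution P (mfun_Sub (mem_set mX)).
pose m2 := distribution gP (mfun_Sub (mem_set mh)).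
have m12 : forall B, measurable B -> m1 B = m2 B.
  apply: tuple_measure_unique; first by apply: (@le_lt_trans _ _ 1%E); rewrite ?ltry//; exact: probability_le1.
  move=> A mA; rewrite /m1 /m2 /distribution /pushforward /=.
  transitivity (\prod_(i < n.+1) gam (A i))%E; first by rewrite -XA.
  rewrite big_ord_recl -tlA//.
  transitivity ((gam \x P)%E (A ord0 `*`
      [set w | forall i, A (lift ord0 i) (tnth (tuple_tail (X w)) i)])).
    rewrite product_measure1E//.
      exact: (mA ord0).
    rewrite (_ : [set w | _] = \big[setI/setT]_(i < n)
        [set w | A (lift ord0 i) (tnth (tuple_tail (X w)) i)]).
      apply: bigsetI_measurable => i _.
      have mt : measurable_fun setT (fun w => tnth (tuple_tail (X w)) i).
        by exact: (measurableT_comp (measurable_tnth i) mtl).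
      by have := mt measurableT _ (mA (lift ord0 i)); rewrite setTI.
    apply/seteqP; split => t /=; first by move=> tA; rewrite -bigcap_seq => i _; exact: tA.
    by rewrite -bigcap_seq => tA i; apply: tA; rewrite /= mem_index_enum.
  congr (_ _); apply/seteqP; split=> -[x w] /=.
    move=> [x0 xA] i; case: (unliftP ord0 i) => [j|] ->; last exact: x0.
    by rewrite tnthS; exact: xA.
  move=> xA; split; first exact: (xA ord0).
  by move=> i; have := xA (lift ord0 i); rewrite tnthS.
transitivity (\int[m1]_t f t)%E; first by rewrite ge0_integral_distribution.
transitivity (\int[m2]_t f t)%E; first by apply: eq_measure_integral => B mB _; exact: m12.
rewrite ge0_integral_distribution// fubini_tonelli1//; last by move=> z; exact: f0.
exact: measurableT_comp.
Qed.
End resample.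
End gauss_pl.

(** * From the line to all dimensions *)

Section tensorization.
Context {R : realType} {d} {T : measurableType d} (P : probability T R).
Notation gam := (normal_prob (0 : R) 1).

(** With the first coordinates [y] and [x] frozen, the induction hypothesis holds for the sections
    with [c * expR (gauss_gap k e s y x)] in place of [c]. The bound it yields is, as a function of
    [y] and [x], the hypothesis of the one-dimensional inequality for the partial integrals. Each
    coordinate contributes one factor [s ^ (- e)]. *)
Lemma gauss_prekopa_leindler (k e s : R) n (X : T -> n.-tuple R) (c : R)
    (p q : n.-tuple R -> \bar R) :
  0 < k -> 0 < e -> k + e = 1 -> 0 < s -> 0 <= c -> gauss_tuple P X ->
  measurable_fun setT p -> measurable_fun setT q ->
  (forall t, 0 <= p t)%E -> (forall t, 0 <= q t)%E ->
  (forall t u, p t `^ k * q u `^ e <=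
    (c * expR (\sum_(i < n) gauss_gap k e s (tnth t i) (tnth u i)))%:E)%E ->
  ((\int[P]_w p (X w)) `^ k * (\int[P]_w q (X w)) `^ e <=
    (c * (s `^ (- e)) ^+ n)%:E)%E.
Proof.
move=> k0 e0 ke s0; elim: n X c p q => [|n IH] X c p q c0 gX mp mq p0 q0 pqc.
  have X0 w : X w = [tuple] by rewrite (tuple0 (X w)).
  under eq_integral do rewrite X0.
  under [X in (_ * X `^ _)%E]eq_integral do rewrite X0.
  rewrite !integral_cst//= probability_setT !mule1 expr0.
  by have := pqc [tuple] [tuple]; rewrite big_ord0 expR0.
have [mX _] := gX.
have gtl := gauss_tuple_tail gX.
have [mtl _] := gtl.
pose cns (x : R) (t : n.-tuple R) : n.+1.-tuple R := [tuple of x :: t].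
have mcns x : measurable_fun setT (cns x) by exact: measurable_cons.
have mcns2 : measurable_fun setT
    (fun z : measurableTypeR R * T => cns z.1 (tuple_tail (X z.2))).
  by apply: measurable_cons => //; exact: (measurableT_comp mtl).
rewrite !gauss_tuple_resample// exprSr mulrA.
have mF (f : n.+1.-tuple R -> \bar R) : measurable_fun setT f -> (forall t, 0 <= f t)%E ->
    measurable_fun setT (fun x : R => \int[P]_w f (cns x (tuple_tail (X w))))%E.
  move=> mf f0.
  apply: (@measurable_fun_fubini_tonelli_F _ _ (measurableTypeR R) T R P
    (fun z => f (cns z.1 (tuple_tail (X z.2))))) => //.
  exact: measurableT_comp.
apply: gauss_prekopa_leindler1 => //.
- by rewrite mulr_ge0// exprn_ge0// powR_ge0.
- exact: mF.
- exact: mF.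
- by move=> x; exact: integral_ge0.
- by move=> x; exact: integral_ge0.
move=> y x.
have := IH (@tuple_tail R n \o X) (c * expR (gauss_gap k e s y x)) (p \o cns y) (q \o cns x).
rewrite /= [X in (_ <= X%:E)%E]mulrAC; apply => //.
- by rewrite mulr_ge0 ?expR_ge0.
- exact: measurableT_comp.
- exact: measurableT_comp.
- move=> t u; apply: (le_trans (pqc _ _)).
  rewrite lee_fin -mulrA ler_wpM2l// -expRD ler_expR big_ord_recl /=.
  by under eq_bigr do rewrite !tnthS.
Qed.
End tensorization.

(** * Scaling and second moment of the normal law *)

Section normal_facts.
Context {R : realType}.
Notation leb := (@lebesgue_measure R).
Notation gam := (normal_prob (0 : R) 1).

Lemma lebesgue_measure_affine (m s : R) (A : set R) : 0 < s -> measurable A ->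
  leb A = (s%:E * leb [set x | A (m + s * x)%R])%E.
Proof.
move=> s0 mA.
have s0' : 0 <= s by exact: ltW.
pose f (x : R) : measurableTypeR R := m + s * x.
have mf : measurable_fun setT f.
  by apply: measurable_funD => //; exact: measurable_funM.
pose M := mscale (NngNum s0') (pushforward leb f).
have : leb A = M mf A; last by [].
apply: lebesgue_measure_unique => //= _ [[a b]] _ <-.
pose I : set R := `](a - m) / s, (b - m) / s]%classic.
transitivity (s%:E * leb I)%E.
  rewrite /I !lebesgue_measure_itv/= !lte_fin ltr_pM2r ?invr_gt0// ltrD2r.
  by case: ifPn => _; rewrite ?mule0// -!EFinB -EFinM; congr (_%:E); field; rewrite gt_eqF.
congr (_ * leb _)%E.
apply/seteqP; split => x; rewrite /I /f /= !in_itv/= ltr_pdivrMr// ler_pdivlMr//;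
  by rewrite ltrBlDr lerBrDr (addrC m) (mulrC s).
Qed.

Lemma ge0_integral_affine (m s : R) (f : R -> \bar R) : 0 < s -> measurable_fun setT f ->
  (forall x, 0 <= f x)%E ->
  (\int[leb]_x f x = s%:E * \int[leb]_x f (m + s * x)%R)%E.
Proof.
move=> s0 mf f0.
have s0' : 0 <= s by exact: ltW.
pose g (x : measurableTypeR R) : measurableTypeR R := m + s * x.
have mg : measurable_fun setT g.
  by apply: measurable_funD => //; exact: measurable_funM.
pose pg : {measure set (measurableTypeR R) -> \bar R} :=
  measure_function_pushforward__canonical__measure_function_Measure leb mg.
have -> : (\int[leb]_x f (m + s * x)%R = \int[pg]_x f x)%E.
  have := ge0_integral_pushforward mg leb measurableT mf (in1W f0).
  by rewrite preimage_setT => /esym.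
have := @ge0_integral_mscale _ _ R pg setT measurableT (NngNum s0') f mf (fun x _ => f0 x).
move=> /= <-.
apply: eq_measure_integral => A mA _.
apply: (eq_trans (lebesgue_measure_affine m s0 mA)).
by rewrite /= /mscale /=; congr (_ * _)%E.
Qed.

Lemma normal_peakV (s : R) : 0 < s -> normal_peak s = normal_peak 1 / s.
Proof.
move=> s0; rewrite /normal_peak expr1n mul1r -mulrnAr sqrtrM ?sqr_ge0//.
by rewrite sqrtr_sqr gtr0_norm// invfM mulrC.
Qed.

Lemma normal_pdf_affine (m s x : R) : 0 < s ->
  s * normal_pdf m s (m + s * x) = normal_pdf 0 1 x.
Proof.
move=> s0; rewrite normal_pdf01E normal_pdfE ?gt_eqF// normal_peakV// /normal_fun.
rewrite (_ : - (m + s * x - m) ^+ 2 / (s ^+ 2 *+ 2) = - (x ^+ 2 / 2)); last first.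
  by rewrite -[_ *+ 2]mulr_natr; field; rewrite gt_eqF.
by field; rewrite gt_eqF.
Qed.

Lemma normal_prob_affine (m s : R) (A : set R) : 0 < s -> measurable A ->
  normal_prob m s A = gam [set x | A (m + s * x)].
Proof.
move=> s0 mA; rewrite /normal_prob integral_mkcond [RHS]integral_mkcond.
rewrite (@ge0_integral_affine m s)//; last 2 first.
- apply/(measurable_restrictT _ _).1 => //.
  by apply/measurable_EFinP/measurable_funTS; exact: measurable_normal_pdf.
- by move=> x; rewrite patchE; case: ifP => // _; rewrite lee_fin normal_pdf_ge0.
rewrite -ge0_integralZl//; last 3 first.
- apply: (@measurableT_comp _ _ _ _ _ _ ((fun x => (normal_pdf m s x)%:E) \_ A)).
    apply/(measurable_restrictT _ _).1 => //.
    by apply/measurable_EFinP/measurable_funTS; exact: measurable_normal_pdf.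
  by apply: measurable_funD => //; exact: measurable_funM.
- by move=> x _; rewrite patchE; case: ifP => // _; rewrite lee_fin normal_pdf_ge0.
- by rewrite lee_fin ltW.
apply: eq_integral => x _; rewrite !patchE.
have -> : (m + s * x \in A) = (x \in [set y | A (m + s * y)]).
  by apply/idP/idP; rewrite !inE.
by case: ifP => _; rewrite ?mule0// -EFinM normal_pdf_affine.
Qed.

Lemma gaussian1_affine (m s : R) (A : set R) : 0 <= s -> measurable A ->
  gaussian1 m (s ^+ 2) A = gam [set x | A (m + s * x)].
Proof.
rewrite le_eqVlt => /predU1P[<-|s0] mA; rewrite /gaussian1; last first.
  by rewrite expf_eq0/= gt_eqF// sqrtr_sqr gtr0_norm// normal_prob_affine.
rewrite expr0n eqxx diracE.
under eq_set do rewrite mul0r addr0.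
have [mA'|mA'] := boolP (m \in A).
  rewrite (_ : [set _ | _] = setT) ?probability_setT//.
  by apply/seteqP; split => // x _; rewrite inE in mA'.
rewrite (_ : [set _ | _] = set0) ?measure0//.
by apply/seteqP; split => // x /= Am; move: mA'; rewrite notin_setE.
Qed.

(** The weight turns the density of [N(0, 1)] into [s] times that of [N(0, s^2)]. *)
Lemma normal_expR_sqr (s : R) : 0 < s ->
  (\int[gam]_x (expR ((1 - s ^- 2) / 2 * x ^+ 2))%:E = s%:E)%E.
Proof.
move=> s0; rewrite ge0_integral_normal//; last first.
  by apply/measurable_EFinP/measurableT_comp => //; exact: measurable_funM.
transitivity (\int[leb]_x (s%:E * (normal_pdf 0 s x)%:E))%E.
  apply: eq_integral => x _; rewrite -!EFinM normal_pdf01E normal_pdfE ?gt_eqF// (normal_peakV s0).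
  rewrite /normal_fun subr0; congr (_%:E).
  have -> : - x ^+ 2 / (s ^+ 2 *+ 2) = (1 - s ^- 2) / 2 * x ^+ 2 + - (x ^+ 2 / 2).
    by rewrite -[s ^+ 2 *+ 2]mulr_natr; field; rewrite gt_eqF.
  rewrite expRD; move: (expR ((1 - _) / 2 * _)) (expR (- _)) (normal_peak 1) => a b c.
  by field; rewrite gt_eqF.
rewrite ge0_integralZl//; last 3 first.
- by apply/measurable_EFinP; exact: measurable_normal_pdf.
- by move=> x _; rewrite lee_fin normal_pdf_ge0.
- by rewrite lee_fin ltW.
by rewrite integral_normal_pdf mule1.
Qed.

Lemma normal_second_moment_lty : (\int[gam]_x (x ^+ 2)%:E < +oo)%E.
Proof.
have mx2 : measurable_fun setT (fun x : R => (x ^+ 2)%:E) by exact/measurable_EFinP.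
(* At [s = 2] the exponent is [3 x^2 / 8], and [u <= exp u] gives the factor [8 / 3]. *)
apply: (@le_lt_trans _ _ (\int[gam]_x ((8 / 3)%:E * (expR ((1 - 2 ^- 2) / 2 * x ^+ 2))%:E))%E).
  apply: ge0_le_integral => //.
  - by move=> x _; rewrite lee_fin sqr_ge0.
  - apply: emeasurable_funM => //; apply/measurable_EFinP/measurableT_comp => //.
    exact: measurable_funM.
  - move=> x _; rewrite -EFinM lee_fin.
    have := expR_ge1Dx ((1 - 2 ^- 2) / 2 * x ^+ 2); set y := expR _ => y0.
    have -> : x ^+ 2 = 8 / 3 * ((1 - 2 ^- 2) / 2 * x ^+ 2) by field.
    by rewrite ler_pM2l ?divr_gt0//; lra.
rewrite ge0_integralZl//; last first.
  by apply/measurable_EFinP/measurableT_comp => //; exact: measurable_funM.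
by rewrite normal_expR_sqr// -EFinM ltry.
Qed.

(* Taken from [E exp(- (s^-2 - 1) Z^2 / 2) = s] as [s] tends to [1]. *)
Lemma normal_second_moment_ge1 : (1 <= \int[gam]_x (x ^+ 2)%:E)%E.
Proof.
have v0 : (0 <= \int[gam]_x (x ^+ 2)%:E)%E.
  by apply: integral_ge0 => x _; rewrite lee_fin sqr_ge0.
have := normal_second_moment_lty; case E : (\int[gam]_x (x ^+ 2)%:E)%E v0 => [v||]// v0 _.
have key (s : R) : 0 < s -> s < 1 -> 1 <= s + (s ^- 2 - 1) / 2 * v.
  move=> s0 s1.
  have t0 : 0 <= (s ^- 2 - 1) / 2.
    by rewrite divr_ge0// subr_ge0 invf_ge1 ?exprn_gt0// expr_le1 ?ltW.
  rewrite -lee_fin EFinD EFinM -E -(normal_expR_sqr s0) -ge0_integralZl//; last 2 first.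
  - exact/measurable_EFinP.
  - by move=> x _; rewrite lee_fin sqr_ge0.
  rewrite -ge0_integralD//; last 3 first.
  - by apply/measurable_EFinP/measurableT_comp => //; exact: measurable_funM.
  - by move=> x _; rewrite -EFinM lee_fin mulr_ge0 ?sqr_ge0.
  - by apply: emeasurable_funM => //; exact/measurable_EFinP.
  apply: (@le_trans _ _ (\int[gam]_x 1)%E).
    by rewrite integral_cst// mul1e; have := @probability_setT _ _ _ gam; rewrite /= => ->.
  apply: ge0_le_integral => //.
  - apply: emeasurable_funD; last by apply: emeasurable_funM => //; exact/measurable_EFinP.
    by apply/measurable_EFinP/measurableT_comp => //; exact: measurable_funM.
  - move=> x _; rewrite -EFinM -EFinD lee_fin.
    by have := expR_ge1Dx ((1 - s ^- 2) / 2 * x ^+ 2); lra.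
rewrite lee_fin leNgt; apply/negP => v1.
move: v0; rewrite lee_fin => v0.
(* Then [v = 2 s - 1], so [2 s^2 - (1 + s) v = 1 - s] is positive, which contradicts [key] at
   [s]. *)
pose s := (1 + v) / 2.
have s0 : 0 < s by rewrite /s; lra.
have s1 : s < 1 by rewrite /s; lra.
have := key s s0 s1.
have -> : s + (s ^- 2 - 1) / 2 * v = 1 - (1 - s) * (1 - (1 + s) / (2 * s ^+ 2) * v).
  by field; rewrite gt_eqF.
have : 0 < (1 - s) * (1 - (1 + s) / (2 * s ^+ 2) * v); last by lra.
rewrite mulr_gt0//; first by lra.
have s2 : 0 < 2 * s ^+ 2 by rewrite mulr_gt0// exprn_gt0.
rewrite subr_gt0 mulrAC ltr_pdivrMr// mul1r /s.
nra.
Qed.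
End normal_facts.

(** * Norms on row vectors *)

Section euclidean.
Context {R : realType} {n : nat}.
Implicit Types x y z : 'rV[R]_n.

Lemma dotvC x y : dotv x y = dotv y x.
Proof. by apply: eq_bigr => i _; rewrite mulrC. Qed.

Lemma dotvDl x y z : dotv (x + y) z = dotv x z + dotv y z.
Proof. by rewrite -big_split; apply: eq_bigr => i _; rewrite mxE mulrDl. Qed.

Lemma dotvZl c x y : dotv (c *: x) y = c * dotv x y.
Proof. by rewrite mulr_sumr; apply: eq_bigr => i _; rewrite mxE mulrA. Qed.

Lemma dotvNl x y : dotv (- x) y = - dotv x y.
Proof. by rewrite -scaleN1r dotvZl mulN1r. Qed.

Lemma dotvDr x y z : dotv z (x + y) = dotv z x + dotv z y.
Proof. by rewrite dotvC dotvDl !(dotvC _ z). Qed.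

Lemma dotvZr c x y : dotv x (c *: y) = c * dotv x y.
Proof. by rewrite dotvC dotvZl dotvC. Qed.

Lemma dotvNr x y : dotv x (- y) = - dotv x y.
Proof. by rewrite dotvC dotvNl dotvC. Qed.

Lemma dotv_ge0 x : 0 <= dotv x x.
Proof. by apply: sumr_ge0 => i _; rewrite -expr2 sqr_ge0. Qed.

Lemma coord_sqr_le x i : x 0 i ^+ 2 <= dotv x x.
Proof.
rewrite /dotv (bigD1 i)//= expr2 lerDl.
by apply: sumr_ge0 => j _; rewrite -expr2 sqr_ge0.
Qed.

Lemma dotv_eq0 x : dotv x x = 0 -> x = 0.
Proof.
move=> x0; apply/rowP => i; rewrite mxE; apply/eqP; rewrite -sqrf_eq0 eq_le sqr_ge0.
by rewrite -x0 coord_sqr_le.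
Qed.

Lemma enorm_ge0 x : 0 <= enorm x. Proof. exact: sqrtr_ge0. Qed.

Lemma enorm_sqr x : enorm x ^+ 2 = dotv x x.
Proof. by rewrite sqr_sqrtr// dotv_ge0. Qed.

Lemma coord_le_enorm x i : `|x 0 i| <= enorm x.
Proof. by rewrite -sqrtr_sqr ler_wsqrtr// coord_sqr_le. Qed.

Lemma enormZ c x : enorm (c *: x) = `|c| * enorm x.
Proof. by rewrite /enorm dotvZl dotvZr mulrA -expr2 sqrtrM ?sqr_ge0// sqrtr_sqr. Qed.

Lemma enorm_eq0 x : enorm x = 0 -> x = 0.
Proof. by move=> x0; apply: dotv_eq0; rewrite -enorm_sqr x0 expr0n. Qed.

Lemma cauchy_schwarz_dotv x y : dotv x y <= enorm x * enorm y.
Proof.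
have [->|x0] := eqVneq x 0; first by rewrite -(scale0r 0) dotvZl enormZ normr0 !mul0r.
have [->|y0] := eqVneq y 0; first by rewrite -(scale0r 0) dotvZr enormZ normr0 !mul0r mulr0.
have ex0 : 0 < enorm x.
  by rewrite lt_neqAle enorm_ge0 andbT eq_sym; apply: contra_neq x0; exact: enorm_eq0.
have ey0 : 0 < enorm y.
  by rewrite lt_neqAle enorm_ge0 andbT eq_sym; apply: contra_neq y0; exact: enorm_eq0.
have := dotv_ge0 (enorm y *: x - enorm x *: y).
rewrite dotvDl !dotvDr !(dotvNl, dotvNr, dotvZl, dotvZr) -!enorm_sqr (dotvC y x).
have := mulr_gt0 ex0 ey0; nra.
Qed.

Lemma enorm_is_norm : is_norm (@enorm R n).
Proof.
split; [exact: enorm_ge0|exact: enorm_eq0|exact: enormZ|move=> x y].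
rewrite -ler_sqr ?nnegrE ?addr_ge0 ?enorm_ge0//.
rewrite sqrrD !enorm_sqr dotvDl !dotvDr (dotvC y x).
by have := cauchy_schwarz_dotv x y; lra.
Qed.

End euclidean.

Section norm_theory.
Context {R : realType} {n : nat}.
Variable K : 'rV[R]_n -> R.
Hypothesis K_norm : is_norm K.
Implicit Types x y z : 'rV[R]_n.

Lemma norm0 : K 0 = 0.
Proof. by rewrite -(scale0r 0) (is_normZ K_norm) normr0 mul0r. Qed.

Lemma normN x : K (- x) = K x.
Proof. by rewrite -scaleN1r (is_normZ K_norm) normrN1 mul1r. Qed.

Lemma norm_gt0 x : x != 0 -> 0 < K x.
Proof.
move=> x0; rewrite lt_neqAle (is_norm_ge0 K_norm) andbT eq_sym.
by apply: contra_neq x0; exact: is_norm_eq0.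
Qed.

Lemma norm_dist x y : `|K x - K y| <= K (x - y).
Proof.
have H u v : K u - K v <= K (u - v).
  by rewrite lerBlDr; have := is_normD K_norm (u - v) v; rewrite subrK.
by rewrite ler_norml H andbT lerNl opprB -[K (x - y)]normN opprB H.
Qed.

Lemma norm_sum (I : Type) (r : seq I) (F : I -> 'rV[R]_n) :
  K (\sum_(i <- r) F i) <= \sum_(i <- r) K (F i).
Proof.
elim: r => [|i r IH]; first by rewrite !big_nil norm0.
by rewrite !big_cons; apply: le_trans (is_normD K_norm _ _) _; rewrite lerD2l.
Qed.

(** A crude Lipschitz constant of [K], for the sup norm and for the Euclidean one. It is available
    before any compactness argument and gives continuity and measurability. *)
Definition norm_basis_sum : R := \sum_(i < n) K (delta_mx 0 i).

Lemma norm_le_coord x M : (forall i, `|x 0 i| <= M) -> K x <= norm_basis_sum * M.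
Proof.
move=> xM; rewrite {1}(row_sum_delta x).
apply: le_trans (norm_sum _ _) _; rewrite mulr_suml; apply: ler_sum => i _.
by rewrite (is_normZ K_norm) mulrC ler_wpM2l// (is_norm_ge0 K_norm).
Qed.

Lemma norm_le_enorm x : K x <= norm_basis_sum * enorm x.
Proof. by apply: norm_le_coord; exact: coord_le_enorm. Qed.

Lemma norm_basis_sum_ge0 : 0 <= norm_basis_sum.
Proof. by apply: sumr_ge0 => i _; exact: (is_norm_ge0 K_norm). Qed.

Lemma norm_continuous : continuous K.
Proof.
move=> x; apply/(@cvgrPdist_le _ R^o _ (nbhs x)) => e e0.
pose C := norm_basis_sum + 1.
have C0 : 0 < C by rewrite ltr_wpDl// norm_basis_sum_ge0.
have eC : 0 < e / C by rewrite divr_gt0.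
have := nbhsx_ballx x _ eC; rewrite -ball_normE /ball_/=.
apply: (@filterS _ (nbhs x)) => y /= xy.
apply: le_trans (norm_dist _ _) _.
apply: (@le_trans _ _ (norm_basis_sum * (e / C))).
  apply: norm_le_coord => i; apply: le_trans (ltW xy).
  rewrite [leRHS]/Num.norm/= mx_normrE.
  by apply: le_trans (le_bigmax _ _ (ord0, i)); rewrite /= ord1.
rewrite mulrA ler_pdivrMr// [leRHS]mulrC ler_wpM2r ?(ltW e0)//.
by rewrite /C lerDl.
Qed.
End norm_theory.

(** * Extrema on the Euclidean sphere and the dual norm *)

Section norm_sphere.
Context {R : realType} {n : nat}.
Hypothesis n0 : (0 < n)%N.
Variable K : 'rV[R]_n -> R.
Hypothesis K_norm : is_norm K.
Implicit Types x y z v w : 'rV[R]_n.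

Let S : set 'rV[R]_n := [set x | enorm x = 1].

Lemma exists_neq0 : exists x : 'rV[R]_n, x != 0.
Proof.
exists (delta_mx 0 (Ordinal n0)); apply/eqP => /rowP/(_ (Ordinal n0)).
by rewrite !mxE !eqxx => /eqP; rewrite oner_eq0.
Qed.

Lemma enorm_gt0 x : x != 0 -> 0 < enorm x.
Proof. exact: (norm_gt0 enorm_is_norm). Qed.

Lemma sphere_neq0 : S !=set0.
Proof.
have [x x0] := exists_neq0; exists ((enorm x)^-1 *: x); rewrite /S/=.
have ex := enorm_gt0 x0.
by rewrite enormZ gtr0_norm ?invr_gt0// mulVf// gt_eqF.
Qed.

Lemma sphere_compact : compact S.
Proof.
apply: bounded_closed_compact.
  exists 1; split; first by rewrite num_real.
  move=> M M1 x Sx; rewrite /= /Num.norm/= mx_normrE.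
  apply/bigmax_leP; split => [|[i j] _ /=]; first by rewrite (le_trans ler01)// ltW.
  by rewrite ord1 (le_trans (coord_le_enorm _ _))// Sx ltW.
apply: (@preimage_closed _ _ (@enorm R n) [set 1 : R]).
  by move=> x _; exact: (norm_continuous enorm_is_norm).
exact: closed_eq.
Qed.

Let normalize x : x != 0 -> S ((enorm x)^-1 *: x).
Proof.
move=> x0; have ex := enorm_gt0 x0; rewrite /S/=.
by rewrite enormZ gtr0_norm ?invr_gt0// mulVf// gt_eqF.
Qed.

Let cK : {within S, continuous K}.
Proof. by apply: continuous_subspaceT; exact: norm_continuous. Qed.

Lemma norm_max_sphere :
  exists x0, enorm x0 = 1 /\ forall x, K x <= K x0 * enorm x.
Proof.
have [x0 /set_mem Sx0 x0P] := EVT_max_rV sphere_neq0 sphere_compact cK.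
exists x0; split=> // x.
have [->|xn0] := eqVneq x 0.
  by rewrite (norm0 K_norm) mulr_ge0 ?enorm_ge0// (is_norm_ge0 K_norm).
have ex := enorm_gt0 xn0.
have := x0P _ (mem_set (normalize xn0)).
by rewrite (is_normZ K_norm) gtr0_norm ?invr_gt0// ler_pdivrMl// mulrC.
Qed.

(** Compactness of the sphere makes the minimum of [K] on it positive. The quotients defining
    [dual_norm] are thereby bounded, so that their [sup] is a genuine supremum and not a default
    value. *)
Lemma norm_ge_enorm : exists2 c, 0 < c & forall x, c * enorm x <= K x.
Proof.
have [x0 /set_mem Sx0 x0P] := EVT_min_rV sphere_neq0 sphere_compact cK.
exists (K x0).
  apply: norm_gt0 => //; apply/eqP => x00; have : enorm x0 = 1 := Sx0.
  by rewrite x00 (norm0 enorm_is_norm) => /esym/eqP; rewrite oner_eq0.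
move=> x; have [->|xn0] := eqVneq x 0; first by rewrite (norm0 K_norm) (norm0 enorm_is_norm) mulr0.
have ex := enorm_gt0 xn0.
have := x0P _ (mem_set (normalize xn0)).
by rewrite (is_normZ K_norm) gtr0_norm ?invr_gt0// ler_pdivlMl// mulrC.
Qed.

Local Notation D := (dual_norm K).

Let dual_has_sup x : has_sup [set dotv x y / K y | y in [set y | y != 0]].
Proof.
have [y0 y0n0] := exists_neq0.
split; first by exists (dotv x y0 / K y0), y0.
have [c c0 cK'] := norm_ge_enorm.
exists (enorm x / c) => _ [y yn0 <-].
rewrite ler_pdivrMr ?norm_gt0// mulrAC ler_pdivlMr//.
apply: (@le_trans _ _ (enorm x * (c * enorm y))).
  by rewrite mulrCA mulrC ler_wpM2l ?(ltW c0)// cauchy_schwarz_dotv.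
by rewrite ler_wpM2l ?enorm_ge0.
Qed.

Lemma dotv_le_dual x y : dotv x y <= D x * K y.
Proof.
have [->|y0] := eqVneq y 0; first by rewrite -(scale0r 0) dotvZr scale0r (norm0 K_norm) mul0r mulr0.
rewrite -ler_pdivrMr ?norm_gt0//; apply: ub_le_sup; last by exists y.
by case: (dual_has_sup x).
Qed.

Lemma dual_norm_le x M : (forall y, dotv x y <= M * K y) -> D x <= M.
Proof.
move=> xM; apply: ge_sup; first by case: (dual_has_sup x).
by move=> _ [y y0 <-]; rewrite ler_pdivrMr// norm_gt0.
Qed.

Lemma dual_norm_ge0 x : 0 <= D x.
Proof.
have [y y0] := exists_neq0.
have := dotv_le_dual x y; have := dotv_le_dual x (- y).
rewrite dotvNr (normN K_norm) => h1 h2.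
rewrite -(pmulr_lge0 _ (norm_gt0 K_norm y0)); lra.
Qed.

Lemma dual_norm_is_norm : is_norm D.
Proof.
have dZ (c : R) x : D (c *: x) <= `|c| * D x.
  apply: dual_norm_le => y; rewrite dotvZl -mulrA.
  apply: (@le_trans _ _ `|c * dotv x y|); first exact: ler_norm.
  rewrite normrM ler_wpM2l// ler_norml dotv_le_dual andbT.
  by rewrite lerNl -dotvNr -(normN K_norm) dotv_le_dual.
split.
- exact: dual_norm_ge0.
- move=> x Dx; apply: dotv_eq0; apply/eqP; rewrite eq_le dotv_ge0 andbT.
  by have := dotv_le_dual x x; rewrite Dx mul0r.
- move=> c x; apply/eqP; rewrite eq_le dZ/=.
  have [->|c0] := eqVneq c 0; first by rewrite normr0 mul0r dual_norm_ge0.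
  have := dZ c^-1 (c *: x); rewrite scalerA mulVf// scale1r normfV ler_pdivlMl//.
  by rewrite normr_gt0.
- move=> x y; apply: dual_norm_le => z; rewrite dotvDl mulrDl.
  by apply: lerD; exact: dotv_le_dual.
Qed.

(* At a maximizer [x0] of [K] on the sphere, the tangent hyperplane of the sphere
   supports the ball of [K], so that no Hahn-Banach argument is needed. *)
Lemma dual_norm_maximizer x0 : enorm x0 = 1 ->
  (forall x, K x <= K x0 * enorm x) -> D (K x0 *: x0) <= 1.
Proof.
move=> x01 x0P; set L := K x0.
have x0n0 : x0 != 0.
  apply/eqP => x00; move: x01; rewrite x00 (norm0 enorm_is_norm) => /esym/eqP.
  by rewrite oner_eq0.
have L0 : 0 < L by exact: norm_gt0.
apply: dual_norm_le => y; rewrite mul1r dotvZl leNgt; apply/negP => yL.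
have Ky0 := is_norm_ge0 K_norm y.
have t0 : 0 < dotv x0 y by rewrite -(pmulr_rgt0 _ L0); exact: le_lt_trans yL.
pose y' := (dotv x0 y)^-1 *: y.
have xy' : dotv x0 y' = 1 by rewrite dotvZr mulVf// gt_eqF.
have Ky' : K y' < L.
  by rewrite (is_normZ K_norm) gtr0_norm ?invr_gt0// ltr_pdivrMl// mulrC.
pose w := y' - x0.
have xx : dotv x0 x0 = 1 by rewrite -enorm_sqr x01 expr1n.
have xw : dotv x0 w = 0 by rewrite dotvDr dotvNr xy' xx subrr.
have W0 := dotv_ge0 w; set W := dotv w w in W0.
(* Since [w] is tangent at [x0], [enorm z] exceeds 1 by at most [ep^2 W / 2], and so does [K z / L].
   As [(1 + ep) x0 = z + ep y'], this gives [ep (L - K y') <= L ep^2 W / 2]. The value of [ep] turns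
   this, after division by [ep^2 L], into [W + 1 <= W / 2], which is absurd. *)
pose ep := (L - K y') / (L * (W + 1)).
have LW : 0 < L * (W + 1) by rewrite mulr_gt0// ltr_wpDl.
have ep0 : 0 < ep by rewrite divr_gt0// subr_gt0.
pose z := x0 - ep *: w.
have zz : dotv z z = 1 + ep ^+ 2 * W.
  rewrite /z dotvDl !dotvDr !(dotvNl, dotvNr, dotvZl, dotvZr) (dotvC w) xw xx -/W; ring.
have ez : enorm z <= 1 + ep ^+ 2 * W / 2.
  by have := sqr_ge0 (enorm z - 1); rewrite sqrrB expr1n mulr1 enorm_sqr zz; lra.
have Kz : K z <= L * (1 + ep ^+ 2 * W / 2).
  by apply: le_trans (x0P z) _; rewrite ler_wpM2l// ltW.
have : (1 + ep) * L <= K z + ep * K y'.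
  have := is_normD K_norm z (ep *: y').
  have -> : z + ep *: y' = (1 + ep) *: x0.
    by rewrite /z /w scalerBr opprB scalerDl scale1r addrA subrK.
  have e1 : 0 < 1 + ep by rewrite addr_gt0.
  by rewrite !(is_normZ K_norm) (gtr0_norm e1) (gtr0_norm ep0).
have epE : ep * (L * (W + 1)) = L - K y' by rewrite /ep divfK// gt_eqF.
move=> h.
have : ep * (L - K y') <= L * (ep ^+ 2 * W / 2) by lra.
rewrite -epE; have : 0 < ep ^+ 2 * L by rewrite mulr_gt0 ?exprn_gt0.
set Q := ep ^+ 2 * L => Q0.
have -> : ep * (ep * (L * (W + 1))) = Q * (W + 1) by rewrite /Q; ring.
have -> : L * (ep ^+ 2 * W / 2) = Q * (W / 2) by rewrite /Q; ring.
by rewrite ler_pM2l//; lra.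
Qed.

(** The maximum [K x0] on the sphere is an element of the set whose supremum is the radius, reached
    at [K x0 *: x0]; that set is bounded because [|v|^2 <= D(v) K(v) <= K(x0) |v|] when [D(v) <= 1].
    This makes the radius a Lipschitz constant of [K], its only link with concentration. *)
Lemma norm_le_dual_ball_radius x : K x <= dual_ball_radius K * enorm x.
Proof.
have [x0 [x01 x0P]] := norm_max_sphere.
apply: le_trans (x0P x) _; rewrite ler_wpM2r ?enorm_ge0//.
rewrite /dual_ball_radius; apply: ub_le_sup; last first.
  exists (K x0 *: x0); first exact: dual_norm_maximizer.
  by rewrite enormZ x01 mulr1 ger0_norm// (is_norm_ge0 K_norm).
exists (K x0) => _ [v Dv <-].
have [->|v0] := eqVneq v 0; first by rewrite (norm0 enorm_is_norm) (is_norm_ge0 K_norm).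
have ev := enorm_gt0 v0.
rewrite -(ler_pM2r ev) -expr2 enorm_sqr; apply: le_trans (dotv_le_dual v v) _.
apply: le_trans (x0P v); rewrite -[leRHS]mul1r ler_wpM2r//.
exact: (is_norm_ge0 K_norm).
Qed.

Lemma dual_ball_radius_gt0 : 0 < dual_ball_radius K.
Proof.
have [x x0] := exists_neq0.
have := norm_le_dual_ball_radius x.
have := norm_gt0 K_norm x0; have := enorm_gt0 x0 => e0 K0 h.
by rewrite -(pmulr_lgt0 _ e0); exact: lt_le_trans h.
Qed.
End norm_sphere.

(** * Gaussian vectors *)

Section row_measurability.
Context {R : realType} {n : nat}.

(** Tuples carry the product sigma-algebra; measurability of a function of rows is expressed by
    composing it with this map. *)
Definition row_of_tuple (t : n.-tuple R) : 'rV[R]_n := \row_i tnth t i.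
Definition tuple_of_row (x : 'rV[R]_n) : n.-tuple R := [tuple x 0 i | i < n].

Lemma tuple_of_rowK : cancel tuple_of_row row_of_tuple.
Proof. by move=> x; apply/rowP => i; rewrite mxE tnth_mktuple. Qed.

Lemma measurable_enorm_row (q : 'rV[R]_n) :
  measurable_fun setT (fun t => enorm (row_of_tuple t - q)).
Proof.
apply: measurableT_comp.
  by apply: continuous_measurable_fun; exact: sqrt_continuous.
rewrite /dotv; apply: measurable_sum => i.
suff mi : measurable_fun setT (fun t => (row_of_tuple t - q) 0 i) by exact: measurable_funM.
rewrite (_ : (fun t => _) = fun t : n.-tuple R => tnth t i - q 0 i).
  by apply: measurable_funB => //; exact: measurable_tnth.
by apply/funext => t; rewrite !mxE.
Qed.

Lemma rat_row_dense (x : 'rV[R]_n) (e : R) : 0 < e ->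
  exists q : 'rV[rat]_n, enorm (x - map_mx ratr q) < e.
Proof.
move=> e0.
pose C : R := norm_basis_sum (@enorm R n) + 1.
have B0 : 0 <= norm_basis_sum (@enorm R n) by exact/norm_basis_sum_ge0/enorm_is_norm.
have C0 : 0 < C by rewrite ltr_wpDl.
pose dl := e / C; have dl0 : 0 < dl by rewrite divr_gt0.
have H i : exists q : rat, `|x 0 i - ratr q| <= dl.
  have [q] := @rat_in_itvoo R (x 0 i - dl) (x 0 i + dl) ltac:(lra).
  rewrite in_itv/= => /andP[q1 q2]; exists q; rewrite ler_norml; lra.
pose q := \row_i xchoose (H i).
exists q; apply: (@le_lt_trans _ _ (norm_basis_sum (@enorm R n) * dl)).
  apply: norm_le_coord => [|i]; first exact: enorm_is_norm.
  by rewrite !mxE; exact: (xchooseP (H i)).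
rewrite /dl mulrA ltr_pdivrMr// mulrC ltr_pM2l// /C; lra.
Qed.

(* [f t < y] iff [f q + C |t - q| < y] for some rational point [q]. *)
Lemma lipschitz_measurable (f : 'rV[R]_n -> R) (C : R) :
  (forall x y, f x <= f y + C * enorm (x - y)) ->
  measurable_fun setT (f \o row_of_tuple).
Proof.
move=> fC0; pose C' := Num.max C 0.
have C'0 : 0 <= C' by rewrite le_max lexx orbT.
have fC x y : f x <= f y + C' * enorm (x - y).
  by apply: le_trans (fC0 x y) _; rewrite lerD2l ler_wpM2r ?enorm_ge0// le_max lexx.
apply: (measurability _ (@RGenInftyO.measurableE R)) => _ [_ [y ->] <-].
rewrite setTI.
pose F (q : 'rV[rat]_n) := [set t : n.-tuple R |
  f (map_mx ratr q) + C' * enorm (row_of_tuple t - map_mx ratr q) < y].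
rewrite (_ : _ @^-1` _ = \bigcup_q F q).
  apply: countable_bigcupT_measurable; first exact: countableP.
  move=> q.
  have mg : measurable_fun setT (fun t : n.-tuple R =>
      f (map_mx ratr q) + C' * enorm (row_of_tuple t - map_mx ratr q)).
    by apply: measurable_funD => //; apply: measurable_funM => //; exact: measurable_enorm_row.
  rewrite (_ : F q = setT `&` (fun t : n.-tuple R =>
      f (map_mx ratr q) + C' * enorm (row_of_tuple t - map_mx ratr q)) @^-1` `]-oo, y[).
    by apply: mg.
  by rewrite setTI; apply/seteqP; split => t; rewrite /F /= in_itv.
apply/seteqP; split => t /=; rewrite in_itv/= => fy; last first.
  by case: fy => q _; apply: le_lt_trans; exact: fC.
set x := row_of_tuple t in fy *.
(* Going from [x] to [q] and back costs the Lipschitz error twice, whence the 2; the [+ 1] covers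
   [C' = 0]. *)
have e0 : 0 < (y - f x) / (2 * (C' + 1)).
  by rewrite divr_gt0 ?subr_gt0// mulr_gt0// ltr_wpDl.
have [q qe] := rat_row_dense x e0; exists q => //; rewrite /F/= -/x.
set z := map_mx ratr q in qe *.
have h1 := fC z x.
rewrite (_ : enorm (z - x) = enorm (x - z)) in h1; last first.
  by rewrite -opprB (normN enorm_is_norm).
have C1 : 0 < 2 * (C' + 1) by rewrite mulr_gt0// ltr_wpDl.
rewrite ltr_pdivlMr// in qe.
have := enorm_ge0 (x - z); nra.
Qed.

Lemma norm_measurable (K : 'rV[R]_n -> R) : is_norm K ->
  measurable_fun setT (K \o row_of_tuple).
Proof.
move=> nK; apply: (@lipschitz_measurable _ (norm_basis_sum K)) => x y.
rewrite -lerBlDl; apply: le_trans (ler_norm _) _; apply: le_trans (norm_dist nK _ _) _.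
exact: norm_le_enorm.
Qed.
End row_measurability.

Section gaussian_vectors.
Context {R : realType} {d} {T : measurableType d} (P : probability T R) {n : nat}.
Notation gam := (normal_prob (0 : R) 1).

Lemma measurable_tuple_of_row (X : T -> 'rV[R]_n) :
  (forall i, measurable_fun setT (fun w => X w 0 i)) ->
  measurable_fun setT (tuple_of_row \o X).
Proof.
move=> mX; apply/measurable_fun_tnthP => i.
by rewrite (_ : _ \o _ = fun w => X w 0 i)//; apply/funext => w /=; rewrite tnth_mktuple.
Qed.

Lemma measurable_comp_row d' (U : measurableType d') (f : 'rV[R]_n -> U) (X : T -> 'rV[R]_n) :
  measurable_fun setT (f \o row_of_tuple) ->
  (forall i, measurable_fun setT (fun w => X w 0 i)) ->
  measurable_fun setT (fun w => f (X w)).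
Proof.
move=> mf mX; have := measurableT_comp mf (measurable_tuple_of_row mX).
by rewrite (_ : _ \o _ = fun w => f (X w))//; apply/funext => w /=; rewrite tuple_of_rowK.
Qed.

Lemma gaussian_vector_tuple (Z : T -> 'rV[R]_n) : gaussian_vector P Z 0 1 ->
  gauss_tuple P (tuple_of_row \o Z).
Proof.
move=> [mZ ZA]; split; first exact: measurable_tuple_of_row.
move=> A mA; rewrite (_ : [set w | _] = [set w | forall i, A i (Z w 0 i)]).
  rewrite ZA//; apply: eq_bigr => i _.
  by rewrite mxE /gaussian1 oner_eq0 sqrtr1.
by apply/seteqP; split => w /= wA i; have := wA i; rewrite tnth_mktuple.
Qed.

(** Boxes determine the law. This is what allows a general Gaussian vector to be replaced by an
    affine image of [Z] inside an expectation. *)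
Lemma gaussian_vector_eq_law (X Y : T -> 'rV[R]_n) (mu : 'rV[R]_n) (v : R)
    (g : 'rV[R]_n -> \bar R) :
  gaussian_vector P X mu v -> gaussian_vector P Y mu v ->
  measurable_fun setT (g \o row_of_tuple) -> (forall x, 0 <= g x)%E ->
  (\int[P]_w g (X w) = \int[P]_w g (Y w))%E.
Proof.
move=> [mX XA] [mY YA] mg g0.
have mX' := measurable_tuple_of_row mX; have mY' := measurable_tuple_of_row mY.
pose m1 := distribution P (mfun_Sub (mem_set mX')).
pose m2 := distribution P (mfun_Sub (mem_set mY')).
have m12 : forall B, measurable B -> m1 B = m2 B.
  apply: tuple_measure_unique.
    by apply: (@le_lt_trans _ _ 1%E); rewrite ?ltry//; exact: probability_le1.
  move=> A mA; rewrite /m1 /m2 /distribution /pushforward /=.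
  transitivity (\prod_(i < n) gaussian1 (mu 0%R i) v (A i))%E.
    rewrite -XA//; congr (P _).
    by apply/seteqP; split => w /= wA i; have := wA i; rewrite tnth_mktuple.
  rewrite -YA//; congr (P _).
  by apply/seteqP; split => w /= wA i; have := wA i; rewrite tnth_mktuple.
have E (W : T -> 'rV[R]_n) (mW : measurable_fun setT (tuple_of_row \o W)) :
    (\int[P]_w g (W w) =
     \int[distribution P (mfun_Sub (mem_set mW))]_t (g \o row_of_tuple) t)%E.
  rewrite ge0_integral_distribution//; last by move=> t; exact: g0.
  by apply: eq_integral => w _ /=; rewrite tuple_of_rowK.
rewrite (E _ mX') (E _ mY').
by apply: eq_measure_integral => B mB _; exact: m12.
Qed.

Lemma gaussian_vector_affine (Z : T -> 'rV[R]_n) (mu : 'rV[R]_n) (s : R) : 0 <= s ->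
  gaussian_vector P Z 0 1 -> gaussian_vector P (fun w => mu + s *: Z w) mu (s ^+ 2).
Proof.
move=> s0 gZ; have [mZ ZA] := gZ; split.
  move=> i; rewrite (_ : (fun w => _) = fun w => mu 0 i + s * Z w 0 i).
    by apply: measurable_funD => //; exact: measurable_funM.
  by apply/funext => w; rewrite !mxE.
move=> A mA.
have mA' i : measurable [set x : R | A i (mu 0 i + s * x)].
  have mf : measurable_fun setT (fun x : R => mu 0 i + s * x).
    by apply: measurable_funD => //; exact: measurable_funM.
  by have := mf measurableT _ (mA i); rewrite setTI.
have := ZA (fun i => [set x | A i (mu 0 i + s * x)]) mA'.
rewrite (_ : [set w | _] = [set w | forall i, A i ((mu + s *: Z w) 0 i)]).
  move=> ->; apply: eq_bigr => i _.
  by rewrite gaussian1_affine// mxE /gaussian1 oner_eq0 sqrtr1.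
by apply/seteqP; split => w /= wA i; have := wA i; rewrite !mxE.
Qed.

Lemma gaussian_vector_coord (Z : T -> 'rV[R]_n) (i : 'I_n) (g : R -> \bar R) :
  gaussian_vector P Z 0 1 -> measurable_fun setT g -> (forall x, 0 <= g x)%E ->
  (\int[P]_w g (Z w 0%R i) = \int[gam]_x g x)%E.
Proof.
move=> gZ mg g0; have [mZ ZA] := gZ.
pose zi : T -> measurableTypeR R := fun w => Z w 0 i.
have mZi : measurable_fun setT zi := mZ i.
pose Zi : {mfun T >-> measurableTypeR R} := mfun_Sub (mem_set mZi).
have := @ge0_integral_distribution _ _ _ (measurableTypeR R) _ P Zi g mg g0.
rewrite /= => <-.
apply: eq_measure_integral => A mA _; rewrite /distribution /pushforward/=.
have := ZA (fun j => if j == i then A else setT).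
rewrite (_ : [set w | _] = (fun w => Z w 0 i) @^-1` A); last first.
  apply/seteqP; split => w /=; first by move=> /(_ i); rewrite eqxx.
  by move=> wA j; case: eqP => // ->.
have mA' j : measurable (if j == i then A else setT) by case: ifP.
move=> /(_ mA') H; apply: (eq_trans H).
rewrite (bigD1 i)//= eqxx big1 ?mule1.
  by rewrite mxE /gaussian1 oner_eq0 sqrtr1.
move=> j ji; rewrite (negbTE ji) mxE /gaussian1 oner_eq0 sqrtr1.
by have := @probability_setT _ _ _ gam.
Qed.

Lemma integral_dotv_gaussian (Z : T -> 'rV[R]_n) : gaussian_vector P Z 0 1 ->
  (\int[P]_w (dotv (Z w) (Z w))%:E = n%:R%:E * \int[gam]_x (x ^+ 2)%:E)%E.
Proof.
move=> gZ; have [mZ _] := gZ.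
under eq_integral do rewrite /dotv -sumEFin.
rewrite ge0_integral_sum//; last 2 first.
- by move=> i; apply/measurable_EFinP; exact: measurable_funM.
- by move=> i w _; rewrite lee_fin -expr2 sqr_ge0.
rewrite (eq_bigr (fun=> \int[gam]_x (x ^+ 2)%:E)%E); last first.
  move=> i _; rewrite -(@gaussian_vector_coord Z i (fun x => (x ^+ 2)%:E))//.
  - exact/measurable_EFinP.
  - by move=> x; rewrite lee_fin sqr_ge0.
rewrite sumr_const card_ord; set v := (X in (X *+ n)%R = _).
elim: n => [|m IH]; first by rewrite mulr0n mul0e.
by rewrite mulrSr IH -natr1 EFinD ge0_muleDl ?lee_fin ?mul1e.
Qed.

Lemma gaussian_prekopa_leindler (k e s : R) (c : R) (Z : T -> 'rV[R]_n)
    (p q : 'rV[R]_n -> R) :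
  0 < k -> 0 < e -> k + e = 1 -> 0 < s -> 0 <= c -> gaussian_vector P Z 0 1 ->
  measurable_fun setT (p \o row_of_tuple) -> measurable_fun setT (q \o row_of_tuple) ->
  (forall y, 0 <= p y) -> (forall x, 0 <= q x) ->
  (forall y x, p y `^ k * q x `^ e <= c * expR ((k * dotv y y + e * dotv x x -
    dotv (k *: y + (e * s) *: x) (k *: y + (e * s) *: x)) / 2)) ->
  ((\int[P]_w (p (Z w))%:E) `^ k * (\int[P]_w (q (Z w))%:E) `^ e <=
    (c * (s `^ (- e)) ^+ n)%:E)%E.
Proof.
move=> k0 e0 ke s0 c0 gZ mp mq p0 q0 pq.
have := @gauss_prekopa_leindler R _ _ P k e s n _ c (fun t => (p (row_of_tuple t))%:E)
  (fun t => (q (row_of_tuple t))%:E) k0 e0 ke s0 c0 (gaussian_vector_tuple gZ).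
under eq_integral do rewrite /= tuple_of_rowK.
under [X in (_ * X `^ _)%E]eq_integral do rewrite /= tuple_of_rowK.
apply.
- exact/measurable_EFinP.
- exact/measurable_EFinP.
- by move=> t; rewrite lee_fin.
- by move=> t; rewrite lee_fin.
move=> t u; rewrite !poweR_EFin -EFinM lee_fin; apply: le_trans (pq _ _) _.
rewrite ler_wpM2l// ler_expR /dotv /gauss_gap -mulr_suml ler_pM2r// le_eqVlt.
apply/orP; left; apply/eqP.
rewrite !mulr_sumr -big_split/= -sumrB; apply: eq_bigr => i _.
by rewrite !mxE; ring.
Qed.
End gaussian_vectors.

(** * Exponential and negative moments *)

Section exp_bounds.
Context {R : realType}.
Implicit Types x y u : R.

Lemma derive_ge0_le (f df : R -> R) : (forall x, is_derive x 1 f (df x)) ->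
  (forall x, 0 <= x -> 0 <= df x) -> forall x, 0 <= x -> f 0 <= f x.
Proof.
move=> fdf df0 x x0; rewrite -subr_ge0.
have [|c] := @MVT_segment R f df 0 x x0 (fun y _ => fdf y).
  by apply: derivable_within_continuous => y _; exact: ex_derive.
rewrite in_itv/= => /andP[c0 _] ->; by rewrite subr0 mulr_ge0 ?df0.
Qed.

Lemma expR_sub_ge u : 0 <= u -> 2 * u <= expR u - expR (- u).
Proof.
move=> u0; rewrite -subr_ge0.
have := @derive_ge0_le (fun x => expR x - expR (- x) - 2 * x)
  (fun x => expR x + expR (- x) - 2) _ _ u u0.
rewrite oppr0 subrr mulr0 subr0; apply.
- move=> x; apply: is_derive_eq.
  by rewrite /GRing.scale/=; ring.
- move=> x _; have := sqr_ge0 (expR (x / 2) - expR (- (x / 2))).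
  rewrite sqrrB -!expRM_natl -expRD subrr expR0.
  rewrite (_ : 2%:R * (x / 2) = x); last by field.
  rewrite (_ : 2%:R * - (x / 2) = - x); last by field.
  lra.
Qed.

Lemma expR_sqr_sub y : (expR (y / 2) - expR (- (y / 2))) ^+ 2 = expR y + expR (- y) - 2.
Proof.
rewrite sqrrB -!expRM_natl -expRD subrr expR0.
rewrite (_ : 2%:R * (y / 2) = y); last by field.
rewrite (_ : 2%:R * - (y / 2) = - y); last by field.
ring.
Qed.

Lemma expR_add_ge2 y : 2 + y ^+ 2 <= expR y + expR (- y).
Proof.
wlog y0 : y / 0 <= y.
  move=> H; have [/H//|/ltW y0] := leP 0 y.
  by have := H (- y); rewrite sqrrN opprK oppr_ge0 [expR (- y) + _]addrC; apply.
have := @expR_sub_ge (y / 2) ltac:(by rewrite divr_ge0).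
rewrite mulrC divfK// => h; have := expR_sqr_sub y.
have : y ^+ 2 <= (expR (y / 2) - expR (- (y / 2))) ^+ 2.
  by rewrite lerXn2r ?nnegrE// (le_trans y0).
lra.
Qed.

Lemma expR_sub_ge3 u : 0 <= u -> 2 * u + u ^+ 3 / 3 <= expR u - expR (- u).
Proof.
move=> u0; rewrite -subr_ge0.
have := @derive_ge0_le (fun x => expR x - expR (- x) - (2 * x + x ^+ 3 / 3))
  (fun x => expR x + expR (- x) - (2 + x ^+ 2)) _ _ u u0.
rewrite oppr0 subrr mulr0 expr0n mul0r addr0 subr0; apply.
- move=> x; apply: is_derive_eq.
  by rewrite /GRing.scale/=; field.
- by move=> x _; rewrite subr_ge0 expR_add_ge2.
Qed.

(** With [u = y / 2], the quantity [e^y + e^-y - 2] is the square of [e^u - e^-u], and squaring the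
    cubic lower bound [2 u + u^3 / 3] of the latter already yields the exact Taylor terms
    [y^2 + y^4 / 12]. *)
Lemma expR_add_ge4 y : 2 + y ^+ 2 + y ^+ 4 / 12 <= expR y + expR (- y).
Proof.
wlog y0 : y / 0 <= y.
  move=> H; have [/H//|/ltW y0] := leP 0 y.
  by have := H (- y); rewrite sqrrN (exprM (- y) 2 2) sqrrN -exprM opprK oppr_ge0 [expR (- y) + _]addrC; apply.
have y2 : 0 <= y / 2 by rewrite divr_ge0.
have := expR_sub_ge3 y2 => h; have := expR_sqr_sub y.
have l0 : 0 <= 2 * (y / 2) + (y / 2) ^+ 3 / 3.
  by rewrite addr_ge0 ?mulr_ge0 ?divr_ge0 ?exprn_ge0.
have : (2 * (y / 2) + (y / 2) ^+ 3 / 3) ^+ 2 <= (expR (y / 2) - expR (- (y / 2))) ^+ 2.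
  by rewrite lerXn2r ?nnegrE// (le_trans l0).
have -> : (2 * (y / 2) + (y / 2) ^+ 3 / 3) ^+ 2 = y ^+ 2 + y ^+ 4 / 12 + y ^+ 6 / 576.
  by field.
have : 0 <= y ^+ 6 by rewrite exprn_ge0.
lra.
Qed.

Lemma expR1_le3 : expR 1 <= 3 :> R.
Proof.
have := expR_ge1Dx (- (1 / 6) : R); set a := expR _ => a56.
(* The bound obtained is [e <= (6 / 5)^6], just below 3. *)
have : a ^+ 6 * expR 1 = 1.
  by rewrite /a -expRM_natl -expRD (_ : _ + _ = 0) ?expR0//; field.
have : (5 / 6) ^+ 6 <= a ^+ 6 by rewrite lerXn2r ?nnegrE ?divr_ge0//; lra.
have := expR_gt0 (1 : R); nra.
Qed.

Lemma expR8_le : expR (8^-1) <= 8 / 7 :> R.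
Proof.
have := expR_ge1Dx (- (8^-1) : R); rewrite expRN => h.
have e0 := expR_gt0 (8^-1 : R).
move: h; rewrite -(ler_pM2r e0) mulVf ?gt_eqF//; lra.
Qed.
End exp_bounds.

(** * Jensen's inequality, and moments from exponential moments *)

Section probability_bounds.
Context {R : realType} {d} {T : measurableType d} (P : probability T R).
Implicit Types X : T -> R.

Lemma integral_cst_prob (c : R) : (\int[P]_w c%:E = c%:E)%E.
Proof. by rewrite integral_cst//= probability_setT mule1. Qed.

Lemma integral_shift X (m c l : R) : P.-integrable setT (EFin \o X) ->
  (\int[P]_w (X w)%:E = m%:E)%E -> (\int[P]_w (c + l * X w)%:E = (c + l * m)%:E)%E.
Proof.
move=> iX Xm; under eq_integral do rewrite EFinD EFinM.
rewrite integralD//=.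
- by rewrite integral_cst_prob integralZl// Xm.
- exact: finite_measure_integrable_cst.
- exact: integrableZl.
Qed.

Lemma integrable_shift X (c l : R) : P.-integrable setT (EFin \o X) ->
  P.-integrable setT (fun w => (c + l * X w)%:E).
Proof.
move=> iX; rewrite (_ : (fun _ => _) = (fun _ => c%:E) \+ (fun w => l%:E * (X w)%:E))%E.
  apply: integrableD => //; first exact: finite_measure_integrable_cst.
  exact: integrableZl.
by apply/funext.
Qed.

Lemma jensen_expR X (m : R) : P.-integrable setT (EFin \o X) ->
  (\int[P]_w (X w)%:E = m%:E)%E -> ((expR m)%:E <= \int[P]_w (expR (X w))%:E)%E.
Proof.
move=> iX Xm; have mX : measurable_fun setT X.
  by move/integrableP : iX => [/measurable_EFinP].
have me : measurable_fun setT (fun w => (expR (X w))%:E).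
  by apply/measurable_EFinP; exact: measurableT_comp.
have [->|efin] := eqVneq (\int[P]_w (expR (X w))%:E)%E +oo%E; first by rewrite leey.
(* The right-hand side is the mean of the tangent to the exponential at [m]. *)
rewrite (_ : expR m = expR m * (1 - m) + expR m * m); last by ring.
rewrite -(integral_shift _ _ iX Xm); apply: le_integral => //.
- exact: integrable_shift.
- apply/integrableP; split => //.
  by under eq_integral do rewrite /= ger0_norm ?expR_ge0//; rewrite ltey.
move=> w _; rewrite lee_fin -(subrK m (X w)) expRD [leRHS]mulrC.
rewrite (_ : _ + _ = expR m * (1 + (X w - m))); last by ring.
by rewrite ler_wpM2l ?expR_ge0// expR_ge1Dx.
Qed.

Section mgf.
Variables (X : T -> R) (b : R).
Hypotheses (mX : measurable_fun setT X) (b0 : 0 <= b).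
Hypothesis mgf_le : forall t, (\int[P]_w (expR (t * X w))%:E <= (expR (t ^+ 2 * b))%:E)%E.

Let mgf_poly (g : T -> R) (t : R) : measurable_fun setT g -> (forall w, 0 <= g w) ->
  (forall w, 2 + g w <= expR (t * X w) + expR (- (t * X w))) ->
  (\int[P]_w (g w)%:E <= (2 * (expR (t ^+ 2 * b) - 1))%:E)%E.
Proof.
move=> mg g0 gP.
have me s : measurable_fun setT (fun w => (expR (s * X w))%:E).
  by apply/measurable_EFinP; apply: measurableT_comp => //; exact: measurable_funM.
have : (\int[P]_w (2 + g w)%:E <= (expR (t ^+ 2 * b))%:E + (expR (t ^+ 2 * b))%:E)%E.
  apply: (@le_trans _ _ (\int[P]_w ((expR (t * X w))%:E + (expR (- t * X w))%:E))%E).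
    apply: ge0_le_integral => //.
    - by move=> w _; rewrite lee_fin addr_ge0.
    - by apply/measurable_EFinP; exact: measurable_funD.
    - exact: emeasurable_funD.
    - by move=> w _; rewrite -EFinD lee_fin mulNr.
  rewrite ge0_integralD//.
  by apply: leeD => //; rewrite -[t ^+ 2]sqrrN.
under eq_integral do rewrite EFinD.
rewrite ge0_integralD//; last 2 first.
- by move=> w _; rewrite lee_fin.
- exact/measurable_EFinP.
rewrite integral_cst_prob -EFinD -leeBrDl// -EFinB => /le_trans; apply.
by rewrite lee_fin; lra.
Qed.

Lemma mgf_moment2 : (\int[P]_w (X w ^+ 2)%:E <= (16 / 7 * b)%:E)%E.
Proof.
have H t : t != 0 -> (\int[P]_w (X w ^+ 2)%:E <=
    (2 * (expR (t ^+ 2 * b) - 1) / t ^+ 2)%:E)%E.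
  move=> t0; have t2 : 0 < t ^+ 2 by rewrite exprn_even_gt0.
  have := @mgf_poly (fun w => t ^+ 2 * X w ^+ 2) t; under eq_integral do rewrite EFinM.
  rewrite ge0_integralZl ?lee_fin//; last 3 first.
  - by apply/measurable_EFinP; exact: measurable_funX.
  - by move=> w _; rewrite lee_fin sqr_ge0.
  - exact: ltW.
  rewrite -lee_pdivlMl// -EFinM mulrC; apply.
  - by apply: measurable_funM => //; exact: measurable_funX.
  - by move=> w; rewrite mulr_ge0 ?sqr_ge0.
  - by move=> w; rewrite -exprMn; exact: expR_add_ge2.
move: b0; rewrite le_eqVlt => /predU1P[b00|bgt0].
  by have := H 1 (oner_neq0 _); rewrite -b00 !mulr0 expR0 subrr mulr0 mul0r.
(* The constant tends to 2 as [t] tends to 0; at [t^2 b = 1 / 8] it is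
   [16 (e^(1/8) - 1) <= 16 / 7]. *)
pose t := Num.sqrt ((8 * b)^-1).
have t2 : t ^+ 2 = (8 * b)^-1 by rewrite sqr_sqrtr// invr_ge0 mulr_ge0.
have tn0 : t != 0 by rewrite -sqrf_eq0 t2 invr_eq0 mulf_neq0 ?gt_eqF.
apply: le_trans (H t tn0) _; rewrite lee_fin t2 invrK.
rewrite (_ : (8 * b)^-1 * b = 8^-1); last by field; rewrite gt_eqF.
have := @expR8_le R; nra.
Qed.

Lemma mgf_moment4 : (\int[P]_w (X w ^+ 4)%:E <= (48 * b ^+ 2)%:E)%E.
Proof.
have H t : t != 0 -> (\int[P]_w (X w ^+ 4)%:E <=
    (24 * (expR (t ^+ 2 * b) - 1) / t ^+ 4)%:E)%E.
  move=> t0; have t4 : 0 < t ^+ 4 / 12 by rewrite divr_gt0// exprn_even_gt0.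
  have := @mgf_poly (fun w => t ^+ 4 / 12 * X w ^+ 4) t; under eq_integral do rewrite EFinM.
  rewrite ge0_integralZl ?lee_fin//; last 3 first.
  - by apply/measurable_EFinP; exact: measurable_funX.
  - by move=> w _; rewrite lee_fin exprn_even_ge0.
  - exact: ltW.
  rewrite -lee_pdivlMl// -EFinM.
  rewrite (_ : _^-1 * _ = 24 * (expR (t ^+ 2 * b) - 1) / t ^+ 4); last by field.
  apply.
  - by apply: measurable_funM => //; exact: measurable_funX.
  - by move=> w; rewrite mulr_ge0 ?(ltW t4)// exprn_even_ge0.
  - move=> w; apply: le_trans (expR_add_ge4 _); rewrite exprMn.
    by have := sqr_ge0 (t * X w); lra.
move: b0; rewrite le_eqVlt => /predU1P[b00|bgt0].
  have := H 1 (oner_neq0 _); rewrite -b00 !mulr0 expR0 subrr mulr0 mul0r.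
  by rewrite expr0n/= mulr0.
(* At [t^2 b = 1] the constant is [24 (e - 1) <= 48]. *)
pose t := Num.sqrt (b^-1).
have t2 : t ^+ 2 = b^-1 by rewrite sqr_sqrtr// invr_ge0.
have tn0 : t != 0 by rewrite -sqrf_eq0 t2 invr_eq0 gt_eqF.
apply: le_trans (H t tn0) _; rewrite lee_fin (exprM t 2 2) t2 exprVn invrK mulVf ?gt_eqF//.
by rewrite ler_wpM2r ?sqr_ge0//; have := @expR1_le3 R; lra.
Qed.
End mgf.
End probability_bounds.

(** * Lipschitz concentration and the Laplace transform of a squared norm *)

Section gaussian_inequalities.
Context {R : realType} {n : nat} {d} {T : measurableType d} (P : probability T R).
Variable Z : T -> 'rV[R]_n.
Hypothesis gZ : gaussian_vector P Z 0 1.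
Notation gam := (normal_prob (0 : R) 1).

Let mZ : forall i, measurable_fun setT (fun w => Z w 0 i) := gZ.1.

Lemma measurable_dotv_row :
  measurable_fun setT ((fun x : 'rV[R]_n => dotv x x) \o row_of_tuple).
Proof.
rewrite (_ : _ \o _ = fun t : n.-tuple R => enorm (row_of_tuple t - 0) ^+ 2).
  by apply: measurable_funX; exact: measurable_enorm_row.
by apply/funext => t /=; rewrite subr0 enorm_sqr.
Qed.

Lemma integrable_dotv : P.-integrable setT (fun w => (dotv (Z w) (Z w))%:E).
Proof.
apply/integrableP; split.
  by apply/measurable_EFinP; apply: (measurable_comp_row measurable_dotv_row).
under eq_integral do rewrite /= ger0_norm ?dotv_ge0//.
rewrite integral_dotv_gaussian//.
have v0 : (0 <= \int[gam]_x (x ^+ 2)%:E)%E.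
  by apply: integral_ge0 => x _; rewrite lee_fin sqr_ge0.
by apply: lte_mul_pinfty => //; exact: normal_second_moment_lty.
Qed.

Section lipschitz.
Variables (f : 'rV[R]_n -> R) (L : R).
Hypotheses (L0 : 0 <= L) (fL : forall x y, f x <= f y + L * enorm (x - y)).

Lemma lipschitz_integrable : P.-integrable setT (fun w => (f (Z w))%:E).
Proof.
have mf := lipschitz_measurable fL.
have iB : P.-integrable setT (fun w => (`|f 0| + L + L * dotv (Z w) (Z w))%:E).
  by apply: (@integrable_shift _ _ _ P (fun w => dotv (Z w) (Z w))); exact: integrable_dotv.
apply: le_integrable iB => //.
  by apply/measurable_EFinP; exact: measurable_comp_row.
move=> w _; rewrite /= lee_fin [leRHS]ger0_norm; last first.
  by rewrite !addr_ge0// mulr_ge0// dotv_ge0.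
have fx := fL (Z w) 0; have f0 := fL 0 (Z w).
have e1 : enorm (Z w) <= 1 + dotv (Z w) (Z w).
  by rewrite -enorm_sqr; have := sqr_ge0 (enorm (Z w) - 1); have := enorm_ge0 (Z w); nra.
have e2 : L * enorm (Z w) <= L + L * dotv (Z w) (Z w).
  by have := ler_wpM2l L0 e1; rewrite mulrDr mulr1.
move: fx f0; rewrite subr0 sub0r (normN enorm_is_norm) => fx f0.
have := ler_norm (f 0); have := ler_norm (- f 0); rewrite normrN => n1 n2.
by rewrite ler_norml; apply/andP; split; lra.
Qed.

(** The inequality for [e^(t f)] and [e^(- t f)] bounds the product of their integrals by
    [e^(t^2 L^2)], and Jensen's inequality bounds the second one below by [e^(- t m)]. The constant
    [c] comes from [|t| L r / 2 <= t^2 L^2 / 2 + r^2 / 8] with [r = |y - x|]. *)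
Lemma lipschitz_mgf (m : R) : (\int[P]_w (f (Z w))%:E = m%:E)%E ->
  forall t, (\int[P]_w (expR (t * (f (Z w) - m)))%:E <= (expR (t ^+ 2 * L ^+ 2))%:E)%E.
Proof.
move=> fm t.
have mf := lipschitz_measurable fL.
have ifZ := lipschitz_integrable.
have me s : measurable_fun setT ((fun x => expR (s * f x)) \o row_of_tuple).
  by apply: measurableT_comp => //; exact: measurable_funM.
have h0 : 0 < (2^-1 : R) by rewrite invr_gt0.
have hh : (2^-1 + 2^-1 : R) = 1 by field.
have := @gaussian_prekopa_leindler R d T P n 2^-1 2^-1 1 (expR (t ^+ 2 * L ^+ 2 / 2)) Z
  (fun x => expR (t * f x)) (fun x => expR (- t * f x)) h0 h0 hh ltr01 (expR_ge0 _) gZ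
  (me t) (me (- t)) (fun _ => expR_ge0 _) (fun _ => expR_ge0 _).
rewrite powR1 expr1n !mulr1 => PL.
have {PL} : ((\int[P]_w (expR (t * f (Z w)))%:E) `^ 2^-1 *
    (\int[P]_w (expR (- t * f (Z w)))%:E) `^ 2^-1 <= (expR (t ^+ 2 * L ^+ 2 / 2))%:E)%E.
  apply: PL => y x; rewrite !powR_expR -!expRD ler_expR.
  have -> : (2^-1 * dotv y y + 2^-1 * dotv x x -
      dotv (2^-1 *: y + 2^-1 *: x) (2^-1 *: y + 2^-1 *: x)) / 2 = enorm (y - x) ^+ 2 / 8.
    rewrite enorm_sqr !dotvDl !dotvDr !(dotvNl, dotvNr, dotvZl, dotvZr) (dotvC y x).
    by field.
  have h1 : t * (f y - f x) <= `|t| * L * enorm (y - x).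
    apply: le_trans (ler_norm _) _; rewrite normrM -mulrA ler_wpM2l//.
    have fyx := fL y x; have fxy := fL x y.
    rewrite -opprB (normN enorm_is_norm) in fxy.
    by rewrite ler_norml; apply/andP; split; lra.
  have -> : t ^+ 2 * L ^+ 2 = (`|t| * L) ^+ 2 by rewrite exprMn real_normK ?num_real.
  have := sqr_ge0 (2 * (`|t| * L) - enorm (y - x)).
  by move: h1; move: (`|t| * L) (enorm _) => a E; lra.
set A := (\int[P]_w (expR (t * f (Z w)))%:E)%E.
set B := (\int[P]_w (expR (- t * f (Z w)))%:E)%E => AB.
have A0 : (0 <= A)%E by apply: integral_ge0 => w _; rewrite lee_fin expR_ge0.
have jB : ((expR (- t * m))%:E <= B)%E.
  apply: (@jensen_expR _ _ _ P (fun w => - t * f (Z w))).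
    by have := @integrable_shift _ _ _ P _ 0 (- t) ifZ; under eq_fun do rewrite add0r.
  by have := integral_shift 0 (- t) ifZ fm; under eq_integral do rewrite add0r; rewrite add0r.
have AE : (A <= (expR (t ^+ 2 * L ^+ 2 + t * m))%:E)%E.
  have {AB} : (A `^ 2^-1 * (expR (- t * m / 2))%:E <= (expR (t ^+ 2 * L ^+ 2 / 2))%:E)%E.
    apply: le_trans AB; apply: lee_wpmul2l; first exact: poweR_ge0.
    rewrite mulrC -powR_expR -poweR_EFin; apply: gt0_ler_poweR => //.
    - by rewrite in_itv/= lee_fin expR_ge0 leey.
    - by rewrite in_itv/= leey andbT; apply: integral_ge0 => w _; rewrite lee_fin expR_ge0.
  rewrite -lee_pdivlMr ?expR_gt0// -EFinM -expRN -expRD => /(@gt0_ler_poweR _ 2 (ler0n _ _)).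
  rewrite -poweRrM mulVf// poweRe1// poweR_EFin powR_expR => H.
  apply: le_trans (H _ _) _.
  - by rewrite in_itv/= poweR_ge0 leey.
  - by rewrite in_itv/= lee_fin expR_ge0 leey.
  by rewrite lee_fin ler_expR; lra.
under eq_integral do rewrite mulrBr expRD mulrC EFinM.
rewrite ge0_integralZl//; last first.
  by apply/measurable_EFinP; exact: (measurable_comp_row (me t)).
apply: (@le_trans _ _ ((expR (- (t * m)))%:E * (expR (t ^+ 2 * L ^+ 2 + t * m))%:E)%E).
  by apply: lee_wpmul2l => //; rewrite lee_fin expR_ge0.
by rewrite -EFinM -expRD lee_fin ler_expR; lra.
Qed.
End lipschitz.

(* The right-hand side is the Laplace transform of [|Z|^2] at [(s^2 - 1) / 2]; by Jensen's
   inequality, the hypothesis on [c] makes the integral of [p] at least [1]. *)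
Lemma norm_sqr_laplace (K D : 'rV[R]_n -> R) (c s : R) : is_norm K -> is_norm D ->
  (forall x y, dotv x y <= D x * K y) -> 0 < c -> 1 < s ->
  P.-integrable setT (fun w => (D (Z w) ^+ 2)%:E) ->
  (\int[P]_w (D (Z w) ^+ 2)%:E <= c%:E * \int[P]_w (dotv (Z w) (Z w))%:E)%E ->
  (\int[P]_w (expR (- ((s ^+ 2 - 1) / 2 * (c * K (Z w) ^+ 2))))%:E <= (s^-1 ^+ n)%:E)%E.
Proof.
move=> nK nD DK c0 s1 iD Dc.
have s0 : 0 < s := lt_trans ltr01 s1.
(* This choice gives [(e s)^2 = e], so the terms in [|x|^2] cancel. The inequality left to prove is
   [e D(y)^2 / c - 2 e s (y . x) + c K(x)^2 >= 0], up to the factor [k / 2]; since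
   [y . x <= D(y) K(x)], the left-hand side is at least [(e s D(y) - c K(x))^2 / c]. *)
pose e := s ^- 2; pose k := 1 - e.
have s2 : 1 < s ^+ 2 by rewrite exprn_egt1.
have e0 : 0 < e by rewrite invr_gt0 exprn_gt0.
have e1 : e < 1 by rewrite invf_lt1// exprn_gt0.
have k0 : 0 < k by rewrite subr_gt0.
have ke : k + e = 1 by rewrite subrK.
have es2 : e * s ^+ 2 = 1 by rewrite mulVf// expf_eq0/= gt_eqF.
have mK := norm_measurable nK; have mD := norm_measurable nD.
pose p y := expR (- (e / 2) * (D y ^+ 2 / c - dotv y y)).
pose q x := expR (- ((s ^+ 2 - 1) / 2 * (c * K x ^+ 2))).
have mp : measurable_fun setT (p \o row_of_tuple).
  apply: measurableT_comp => //; apply: measurable_funM => //; apply: measurable_funB.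
    by apply: measurable_funM => //; exact: measurable_funX.
  exact: measurable_dotv_row.
have mq : measurable_fun setT (q \o row_of_tuple).
  apply: measurableT_comp => //; apply: measurableT_comp => //.
  by do 2 apply: measurable_funM => //; exact: measurable_funX.
have := @gaussian_prekopa_leindler R d T P n k e s 1 Z p q k0 e0 ke s0 ler01 gZ mp mq
  (fun _ => expR_ge0 _) (fun _ => expR_ge0 _).
rewrite mul1r => PL.
have {PL} : ((\int[P]_w (p (Z w))%:E) `^ k * (\int[P]_w (q (Z w))%:E) `^ e <=
    ((s `^ (- e)) ^+ n)%:E)%E.
  apply: PL => y x; rewrite mul1r !powR_expR -expRD ler_expR.
  have DKyx := DK y x.
  rewrite !dotvDl !dotvDr !dotvZl !dotvZr (dotvC x y).
  have A0 : 0 <= (e * s * D y - c * K x) ^+ 2 / c by rewrite divr_ge0 ?sqr_ge0// ltW.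
  have ees : (e * s) ^+ 2 = e by rewrite exprMn expr2 -mulrA es2 mulr1.
  have AE : (e * s * D y - c * K x) ^+ 2 / c =
      e * (D y ^+ 2 / c) - 2 * (e * s) * (D y * K x) + c * K x ^+ 2.
    rewrite sqrrB exprMn ees; field; by rewrite gt_eqF.
  have es0 : 0 < e * s by rewrite mulr_gt0.
  have B0 : 0 <= e * (D y ^+ 2 / c) - 2 * (e * s) * dotv y x + c * K x ^+ 2.
    by have := ler_wpM2l (ltW es0) DKyx; move: A0; rewrite AE; lra.
  have ek : e * (s ^+ 2 - 1) = k by rewrite mulrBr es2 mulr1.
  have := mulr_ge0 (ltW k0) B0.
  rewrite (_ : e * - ((s ^+ 2 - 1) / 2 * (c * K x ^+ 2)) = - (k * (c * K x ^+ 2)) / 2); last first.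
    by rewrite -ek; ring.
  rewrite (_ : k * (k * dotv y y) = k * dotv y y - k * e * dotv y y); last first.
    by rewrite /k; ring.
  rewrite (_ : e * s * (e * s * dotv x x) = e * dotv x x); last first.
    by rewrite mulrA -expr2 ees.
  set dyy := dotv y y; set dxx := dotv x x; set dyx := dotv y x.
  set Dc' := D y ^+ 2 / c; set cK := c * K x ^+ 2; set es := e * s => h.
  rewrite -subr_ge0; apply: le_trans (_ : 0 <= k * (e * Dc' - 2 * es * dyx + cK) / 2) _.
    by rewrite divr_ge0.
  by rewrite le_eqVlt; apply/orP; left; apply/eqP; field.
set A := (\int[P]_w (p (Z w))%:E)%E; set B := (\int[P]_w (q (Z w))%:E)%E => AB.
have B0 : (0 <= B)%E by apply: integral_ge0 => w _; rewrite lee_fin expR_ge0.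
have iN := integrable_dotv.
have A1 : (1 <= A)%E.
  have iX : P.-integrable setT (EFin \o (fun w => - (e / 2) * (D (Z w) ^+ 2 / c - dotv (Z w) (Z w)))).
    rewrite (_ : _ \o _ = fun w => (- (e / 2) / c)%:E * (D (Z w) ^+ 2)%:E +
        (e / 2)%:E * (dotv (Z w) (Z w))%:E)%E.
      by apply: integrableD => //; exact: integrableZl.
    by apply/funext => w /=; rewrite -!EFinM -EFinD; congr (_%:E); ring.
  have fD : (\int[P]_w (D (Z w) ^+ 2)%:E)%E \is a fin_num by exact: integrable_fin_num.
  have fN : (\int[P]_w (dotv (Z w) (Z w))%:E)%E \is a fin_num by exact: integrable_fin_num.
  set ED := fine (\int[P]_w (D (Z w) ^+ 2)%:E)%E.
  set EN := fine (\int[P]_w (dotv (Z w) (Z w))%:E)%E.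
  have Xm : (\int[P]_w (- (e / 2) * (D (Z w) ^+ 2 / c - dotv (Z w) (Z w)))%:E =
      (- (e / 2) / c * ED + e / 2 * EN)%:E)%E.
    rewrite EFinD !EFinM !fineK// -!EFinM -!integralZl//.
    rewrite -integralD//; [|exact: integrableZl|exact: integrableZl].
    by apply: eq_integral => w _; rewrite -!EFinM -EFinD; congr (_%:E); ring.
  apply: le_trans (jensen_expR iX Xm).
  rewrite lee_fin -[leLHS]expR0 ler_expR.
  have : ED <= c * EN by rewrite -lee_fin EFinM !fineK.
  rewrite -(ler_pM2l (divr_gt0 e0 c0)) => h.
  have -> : - (e / 2) / c * ED + e / 2 * EN = (e / c * (c * EN) - e / c * ED) / 2.
    by field; rewrite gt_eqF.
  by rewrite divr_ge0// subr_ge0.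
have Bpow : (B `^ e <= ((s `^ (- e)) ^+ n)%:E)%E.
  apply: le_trans AB; rewrite -[leLHS]mul1e; apply: lee_wpmul2r; first exact: poweR_ge0.
  rewrite -[leLHS](poweR1r k); apply: gt0_ler_poweR => //; first exact: ltW.
    by rewrite in_itv/= lee_fin ler01 leey.
  by rewrite in_itv/= leey andbT (le_trans _ A1)// lee_fin.
have := @gt0_ler_poweR _ e^-1 _ _ _ _ _ Bpow.
rewrite -poweRrM divff ?gt_eqF// poweRe1// poweR_EFin => H.
apply: le_trans (H _ _ _) _.
- by rewrite invr_ge0 ltW.
- by rewrite in_itv/= poweR_ge0 leey.
- by rewrite in_itv/= lee_fin exprn_ge0 ?powR_ge0// leey.
rewrite lee_fin le_eqVlt; apply/orP; left; apply/eqP.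
rewrite -powR_mulrn ?powR_ge0// -!powRrM.
rewrite [X in _ `^ X](_ : _ = - n%:R); last by field; rewrite gt_eqF.
by rewrite powRN powR_mulrn ?(ltW s0)// exprVn.
Qed.
End gaussian_inequalities.

(** * Explicit Laplace integrals *)

Section laplace_integrals.
Context {R : realType}.
Notation leb := (@lebesgue_measure R).

Lemma integral_0y_antiderivative (F f : R -> R) (C a : R) :
  (forall x : R, is_derive x (1 : R) F (f x)) -> continuous f ->
  (forall x, 0 <= x -> 0 <= f x) -> 0 < a ->
  (forall x, 0 <= x -> `|F x| <= C * expR (- (a * x))) ->
  (\int[leb]_(x in `[0%R, +oo[) (f x)%:E = (- F 0)%:E)%E.
Proof.
move=> Ff cf f0 a0 FC.
have dF x : derivable F x 1 by exact: ex_derive.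
rewrite (@ge0_continuous_FTC2y _ f F 0 0) ?sub0e//.
- exact: continuous_subspaceT.
- have C0 : (fun x => C * expR (- (a * x))) @ +oo --> (0 : R).
    rewrite -[X in _ --> X](mulr0 C); apply: cvgM; first exact: cvg_cst.
    apply: (cvg_comp (fun x => a * x) (fun x => expR (- x))); last exact: cvgr_expR.
    by apply: gt0_cvgMry => //; exact: cvg_id.
  apply/norm_cvg0P; apply: (@squeeze_cvgr _ _ _ _ (fun=> 0) (fun x => C * expR (- (a * x)))).
  - near=> x; rewrite normr_ge0/=; apply: FC; near: x; exact: nbhs_pinfty_ge.
  - exact: cvg_cst.
  - exact: C0.
- apply: cvg_at_right_filter; apply: differentiable_continuous; exact/derivable1_diffP.
- by move=> x _; rewrite derive1E; exact: derive_val.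
Unshelve. all: by end_near. Qed.

(* The substitution [t = (exp (2 r) - 1) / 2] in Laplace integrals over [t >= 0]. *)
Definition ltime (r : R) := (expR (2 * r) - 1) / 2.

Lemma ltime_ge r : r <= ltime r.
Proof. by have := expR_ge1Dx (2 * r); rewrite /ltime; lra. Qed.

Lemma ltime_ge0 r : 0 <= r -> 0 <= ltime r.
Proof. by move=> r0; exact: le_trans (ltime_ge r). Qed.

Lemma ltime0 : ltime 0 = 0.
Proof. by rewrite /ltime mulr0 expR0 subrr mul0r. Qed.

Lemma is_derive_ltime (r : R) : is_derive r (1 : R) ltime (expR (2 * r)).
Proof. by rewrite /ltime; apply: is_derive_eq; rewrite /GRing.scale/=; field. Qed.

Lemma is_derive_expRM (a r : R) : is_derive r (1 : R) (fun x => expR (- (a * x))) (- a * expR (- (a * r))).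
Proof. by apply: is_derive_eq; rewrite /GRing.scale/=; ring. Qed.

Lemma is_derive_laplace (u r : R) :
  is_derive r (1 : R) (fun r => expR (- (ltime r * u))) (- u * (expR (2 * r) * expR (- (ltime r * u)))).
Proof.
have H := is_derive_ltime r.
by apply: is_derive_eq; rewrite /GRing.scale/=; ring.
Qed.

Lemma continuous_ltime : continuous ltime.
Proof.
move=> r; apply: differentiable_continuous; apply/derivable1_diffP.
by have := is_derive_ltime r => H; exact: ex_derive.
Qed.

Lemma continuous_expRM (a : R) : continuous (fun x => expR (a * x)).
Proof.
move=> r; apply: differentiable_continuous; apply/derivable1_diffP; exact: ex_derive.
Qed.

Lemma continuous_laplace u : continuous (fun r => expR (- (ltime r * u))).
Proof.
move=> r; apply: differentiable_continuous; apply/derivable1_diffP.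
by have := is_derive_laplace u r => H; exact: ex_derive.
Qed.

Lemma laplace_le u r : 0 < u -> 0 <= r -> expR (- (ltime r * u)) <= expR (- (u / 2 * r)).
Proof.
move=> u0 r0; rewrite ler_expR lerN2.
have := ler_wpM2r (ltW u0) (ltime_ge r); have := mulr_ge0 (ltW u0) r0; lra.
Qed.

Lemma integral_laplace1 u : 0 < u ->
  (\int[leb]_(r in `[0%R, +oo[) (expR (2 * r) * expR (- (ltime r * u)))%:E = (u^-1)%:E)%E.
Proof.
move=> u0; pose F r := - u^-1 * expR (- (ltime r * u)).
have Fd : forall r : R, is_derive r (1 : R) F (expR (2 * r) * expR (- (ltime r * u))).
  move=> r; have H := is_derive_laplace u r.
  by apply: is_derive_eq; rewrite /GRing.scale/=; field; rewrite gt_eqF.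
rewrite (@integral_0y_antiderivative F _ u^-1 (u / 2) Fd).
- by rewrite /F ltime0 mul0r oppr0 expR0 mulr1 opprK.
- by move=> r; apply: cvgM; [exact: continuous_expRM|exact: continuous_laplace].
- by move=> r _; rewrite mulr_ge0 ?expR_ge0.
- by rewrite divr_gt0.
- move=> r r0; rewrite /F normrM normrN [`|expR _|]ger0_norm ?expR_ge0// ger0_norm ?invr_ge0 ?(ltW u0)//.
  by rewrite ler_wpM2l ?invr_ge0 ?(ltW u0)// laplace_le.
Qed.

Lemma integral_laplace2 u : 0 < u ->
  (\int[leb]_(r in `[0%R, +oo[) (ltime r * expR (2 * r) * expR (- (ltime r * u)))%:E =
   (u ^- 2)%:E)%E.
Proof.
move=> u0; pose F r := - (ltime r / u + u ^- 2) * expR (- (ltime r * u)).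
have Fd : forall r : R, is_derive r (1 : R) F (ltime r * expR (2 * r) * expR (- (ltime r * u))).
  move=> r; have H := is_derive_laplace u r; have H' := is_derive_ltime r.
  by apply: is_derive_eq; rewrite /GRing.scale/=; field; rewrite gt_eqF.
rewrite (@integral_0y_antiderivative F _ (3 * u ^- 2) (u / 2) Fd).
- by rewrite /F ltime0 !mul0r oppr0 expR0 mulr1 opprK add0r.
- move=> r; apply: cvgM; last exact: continuous_laplace.
  by apply: cvgM; [exact: continuous_ltime|exact: continuous_expRM].
- by move=> r r0; rewrite mulr_ge0 ?expR_ge0// mulr_ge0 ?expR_ge0// ltime_ge0.
- by rewrite divr_gt0.
- move=> r r0; rewrite /F normrM normrN [`|expR _|]ger0_norm ?expR_ge0//.
  have t0 := ltime_ge0 r0.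
  have c0 : 0 <= ltime r / u + u ^- 2.
    by rewrite addr_ge0// ?invr_ge0 ?exprn_ge0 ?(ltW u0)// divr_ge0 ?(ltW u0).
  rewrite (ger0_norm c0).
  (* Half of the exponential absorbs the polynomial factor, by [(1 + 2 y) exp (- y) <= 3]; the other
     half gives the decay. *)
  set y := ltime r * u / 2.
  have y0 : 0 <= y by rewrite divr_ge0// mulr_ge0// ltW.
  have -> : expR (- (ltime r * u)) = expR (- y) * expR (- y).
    by rewrite -expRD; congr expR; rewrite /y; field.
  have ey : expR (- y) <= expR (- (u / 2 * r)).
    rewrite ler_expR lerN2 /y; have := ler_wpM2r (ltW u0) (ltime_ge r); lra.
  have ye : (1 + 2 * y) * expR (- y) <= 3.
    rewrite expRN ler_pdivrMr ?expR_gt0//; have := expR_ge1Dx y; lra.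
  have -> : ltime r / u + u ^- 2 = u ^- 2 * (1 + 2 * y).
    by rewrite /y; field; rewrite gt_eqF.
  rewrite mulrA -[X in X * _]mulrA.
  apply: ler_pM => //; rewrite ?mulr_ge0 ?expR_ge0 ?invr_ge0 ?exprn_ge0 ?(ltW u0)//.
    by rewrite addr_ge0// mulr_ge0.
  by rewrite [leRHS]mulrC ler_wpM2l// invr_ge0 exprn_ge0// ltW.
Qed.

Lemma integral_power1 (v : R) : 2 < v ->
  (\int[leb]_(r in `[0%R, +oo[) (expR (2 * r) * expR (- (v * r)))%:E = ((v - 2)^-1)%:E)%E.
Proof.
move=> v2; have v20 : 0 < v - 2 by rewrite subr_gt0.
pose F r := - (v - 2)^-1 * expR (- ((v - 2) * r)).
have Fd : forall r : R, is_derive r (1 : R) F (expR (2 * r) * expR (- (v * r))).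
  move=> r; have H := is_derive_expRM (v - 2) r.
  apply: is_derive_eq; rewrite -expRD (_ : 2 * r + - (v * r) = - ((v - 2) * r)); last by ring.
  by rewrite /GRing.scale/=; field; rewrite gt_eqF.
rewrite (@integral_0y_antiderivative F _ (v - 2)^-1 (v - 2) Fd).
- by rewrite /F mulr0 oppr0 expR0 mulr1 opprK.
- move=> r; apply: cvgM; first exact: continuous_expRM.
  by under eq_fun do rewrite -mulNr; rewrite -mulNr; exact: continuous_expRM.
- by move=> r _; rewrite mulr_ge0 ?expR_ge0.
- exact: v20.
- by move=> r r0; rewrite /F normrM normrN [`|expR _|]ger0_norm ?expR_ge0// ger0_norm// invr_ge0 ltW.
Qed.

Lemma integral_power2 (v : R) : 4 < v ->
  (\int[leb]_(r in `[0%R, +oo[) (ltime r * expR (2 * r) * expR (- (v * r)))%:E =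
   (((v - 2) * (v - 4))^-1)%:E)%E.
Proof.
move=> v4; have v20 : 0 < v - 2 by lra. have v40 : 0 < v - 4 by lra.
(* The integrand is [(exp (- (v - 4) r) - exp (- (v - 2) r)) / 2]. *)
pose F r := (- (v - 4)^-1 * expR (- ((v - 4) * r)) + (v - 2)^-1 * expR (- ((v - 2) * r))) / 2.
have Fd : forall r : R, is_derive r (1 : R) F (ltime r * expR (2 * r) * expR (- (v * r))).
  move=> r; have H := is_derive_expRM (v - 2) r; have H' := is_derive_expRM (v - 4) r.
  have E2 : expR (- ((v - 2) * r)) = expR (2 * r) * expR (- (v * r)).
    by rewrite -expRD; congr expR; ring.
  have E4 : expR (- ((v - 4) * r)) = expR (2 * r) * (expR (2 * r) * expR (- (v * r))).
    by rewrite -!expRD; congr expR; ring.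
  apply: is_derive_eq; rewrite /ltime /GRing.scale/= E2 E4.
  by field; rewrite !gt_eqF.
rewrite (@integral_0y_antiderivative F _ ((v - 4)^-1 + (v - 2)^-1) (v - 4) Fd).
- rewrite /F !mulr0 oppr0 expR0 !mulr1; congr (_%:E).
  by field; rewrite !gt_eqF.
- move=> r; apply: cvgM.
    by apply: cvgM; [exact: continuous_ltime|exact: continuous_expRM].
  by under eq_fun do rewrite -mulNr; rewrite -mulNr; exact: continuous_expRM.
- by move=> r r0; rewrite mulr_ge0 ?expR_ge0// mulr_ge0 ?expR_ge0// ltime_ge0.
- exact: v40.
- move=> r r0; have e24 : expR (- ((v - 2) * r)) <= expR (- ((v - 4) * r)).
    by rewrite ler_expR lerN2 ler_wpM2r//; lra.
  have i4 : 0 < (v - 4)^-1 by rewrite invr_gt0.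
  have i2 : 0 < (v - 2)^-1 by rewrite invr_gt0.
  have e4 := expR_gt0 (- ((v - 4) * r)); have e2 := expR_gt0 (- ((v - 2) * r)).
  have m4 := mulr_gt0 i4 e4; have m2 := mulr_gt0 i2 e2.
  have m24 := ler_wpM2l (ltW i2) e24.
  rewrite /F ler_norml mulrDl; apply/andP; split; lra.
Qed.
End laplace_integrals.

Lemma measurable_funV_ge0 {R : realType} d (T : measurableType d) (X : T -> R) :
  measurable_fun setT X -> (forall w, 0 <= X w) -> measurable_fun setT (fun w => (X w)^-1).
Proof.
move=> mX X0; rewrite (_ : (fun _ => _) = fun w => X w `^ (-1)).
  exact: (measurableT_comp (measurable_powR _)).
by apply/funext => w; rewrite powR_inv1.
Qed.

(** * Negative moments from a bound on the Laplace transform *)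

Section negative_moments.
Context {R : realType} {d} {T : measurableType d} (P : probability T R).
Notation leb := (@lebesgue_measure R).
Variables (U : T -> R) (v : R).
Hypotheses (mU : measurable_fun setT U) (U0 : forall w, 0 <= U w).
Hypothesis laplaceU : forall r, 0 <= r ->
  (\int[P]_w (expR (- (ltime r * U w)))%:E <= (expR (- (v * r)))%:E)%E.

Let mltime : measurable_fun setT (@ltime R).
Proof. by apply: continuous_measurable_fun; exact: continuous_ltime. Qed.

Section weight.
Variable h : R -> R.
Hypotheses (mh : measurable_fun setT h) (h0 : forall r, 0 <= r -> 0 <= h r).

Let J := `[0%R, +oo[%classic : set R.
Let f (z : T * measurableTypeR R) : \bar R :=
  (\1_J z.2 * (h z.2 * expR (- (ltime z.2 * U z.1))))%:E.

Let f0 z : (0 <= f z)%E.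
Proof.
rewrite /f lee_fin indicE; case: (boolP (z.2 \in J)) => zJ; rewrite ?mul0r// mul1r.
by move: zJ; rewrite inE /J/= in_itv/= andbT => z0; rewrite mulr_ge0 ?h0 ?expR_ge0.
Qed.

Let mJ : measurable_fun setT (\1_J : R -> R).
Proof. by apply: measurable_indic; exact: measurable_itv. Qed.

Let mf : measurable_fun setT f.
Proof.
apply/measurable_EFinP; apply: measurable_funM; first exact: (measurableT_comp mJ measurable_snd).
apply: measurable_funM; first exact: (measurableT_comp mh measurable_snd).
apply: measurableT_comp => //; apply: measurableT_comp => //; apply: measurable_funM.
  exact: (measurableT_comp mltime measurable_snd).
exact: (measurableT_comp mU measurable_fst).
Qed.

Let indE (g : R -> R) : (\int[leb]_(r in J) (g r)%:E = \int[leb]_r (\1_J r * g r)%:E)%E.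
Proof.
rewrite integral_mkcond; apply: eq_integral => r _; rewrite patchE indicE.
by case: ifP => _; rewrite ?mul1r ?mul0r.
Qed.

Lemma measurable_laplace :
  measurable_fun setT (fun w => \int[leb]_(r in `[0%R, +oo[) (h r * expR (- (ltime r * U w)))%:E)%E.
Proof.
under eq_fun do rewrite indE.
exact: (@measurable_fun_fubini_tonelli_F _ _ T (measurableTypeR R) R leb f mf f0).
Qed.

Lemma integral_laplace_le :
  (\int[P]_w \int[leb]_(r in `[0%R, +oo[) (h r * expR (- (ltime r * U w)))%:E <=
   \int[leb]_(r in `[0%R, +oo[) (h r * expR (- (v * r)))%:E)%E.
Proof.
under eq_integral do rewrite indE.
rewrite indE.
rewrite [leLHS](_ : _ = \int[leb]_r \int[P]_w f (w, r))%E; last first.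
  exact: (@fubini_tonelli _ _ T (measurableTypeR R) R P leb f mf f0).
apply: ge0_le_integral => //.
- by move=> r _; apply: integral_ge0 => w _; exact: f0.
- exact: (@measurable_fun_fubini_tonelli_G _ _ T (measurableTypeR R) R P f mf f0).
- apply/measurable_EFinP; apply: measurable_funM => //.
  apply: measurable_funM => //; apply: measurableT_comp => //; apply: measurableT_comp => //.
move=> r _; rewrite /f/=.
under eq_integral do rewrite mulrA EFinM.
have lap r' : measurable_fun setT (fun w => (expR (- (ltime r' * U w)))%:E).
  apply/measurable_EFinP; apply: measurableT_comp => //; apply: measurableT_comp => //.
  exact: measurable_funM.
have Jh : 0 <= \1_J r * h r.
  rewrite indicE; case: (boolP (r \in J)) => rJ; rewrite ?mul0r// mul1r.
  by apply: h0; move: rJ; rewrite inE /J/= in_itv/= andbT.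
rewrite ge0_integralZl ?lee_fin//.
apply: (@le_trans _ _ ((\1_J r * h r)%:E * (expR (- (v * r)))%:E)%E); last first.
  by rewrite -EFinM mulrA.
move: Jh; rewrite indicE; case: (boolP (r \in J)) => rJ Jh; last by rewrite !mul0r !mul0e.
apply: lee_wpmul2l; first by rewrite lee_fin.
by apply: laplaceU; move: rJ; rewrite inE /J/= in_itv/= andbT.
Qed.
End weight.

Lemma negative_moment1 : 2 < v -> (\int[P]_w ((U w)^-1)%:E <= ((v - 2)^-1)%:E)%E.
Proof.
move=> v2; rewrite -(integral_power1 v2).
have mh : measurable_fun setT (fun r : R => expR (2 * r)).
  by apply: measurableT_comp => //; exact: measurable_funM.
have h0 (r : R) : 0 <= r -> 0 <= expR (2 * r) by rewrite expR_ge0.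
apply: le_trans (integral_laplace_le mh h0).
apply: ge0_le_integral => //.
- by move=> w _; rewrite lee_fin invr_ge0.
- by apply/measurable_EFinP; exact: measurable_funV_ge0.
- exact: measurable_laplace.
(* Where [U] vanishes its inverse is 0 by convention, so the bound is trivial there. *)
move=> w _; have [->|u0] := eqVneq (U w) 0.
  by rewrite invr0; apply: integral_ge0 => r _; rewrite lee_fin mulr_ge0 ?expR_ge0.
by rewrite integral_laplace1// lt_neqAle eq_sym u0/=.
Qed.

Lemma negative_moment2 : 4 < v ->
  (\int[P]_w ((U w) ^- 2)%:E <= (((v - 2) * (v - 4))^-1)%:E)%E.
Proof.
move=> v4; rewrite -(integral_power2 v4).
have mh : measurable_fun setT (fun r : R => ltime r * expR (2 * r)).
  by apply: measurable_funM => //; apply: measurableT_comp => //; exact: measurable_funM.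
have h0 (r : R) : 0 <= r -> 0 <= ltime r * expR (2 * r).
  by move=> r0; rewrite mulr_ge0 ?expR_ge0 ?ltime_ge0.
apply: le_trans (integral_laplace_le mh h0).
apply: ge0_le_integral => //.
- by move=> w _; rewrite lee_fin invr_ge0 exprn_ge0.
- by apply/measurable_EFinP; apply: measurable_funV_ge0 => [|w]; [exact: measurable_funX|exact: exprn_ge0].
- exact: measurable_laplace.
move=> w _; have [->|u0] := eqVneq (U w) 0.
  rewrite expr0n invr0; apply: integral_ge0 => r; rewrite /= in_itv/= andbT => r0.
  by rewrite lee_fin mulr_ge0 ?expR_ge0// h0.
by rewrite integral_laplace2// lt_neqAle eq_sym u0/=.
Qed.
End negative_moments.

(** * Cauchy-Schwarz and the fourth moment of a centred perturbation *)

Section moment_bounds.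
Context {R : realType} {d} {T : measurableType d} (P : probability T R).
Implicit Types X Y G : T -> R.

Lemma cauchy_schwarz_integral X Y (A C : R) : measurable_fun setT X -> measurable_fun setT Y ->
  (forall w, 0 <= X w) -> (forall w, 0 <= Y w) -> 0 <= A -> 0 < C ->
  (\int[P]_w (X w ^+ 2)%:E <= (A ^+ 2)%:E)%E -> (\int[P]_w (Y w ^+ 2)%:E <= (C ^+ 2)%:E)%E ->
  (\int[P]_w (X w * Y w)%:E <= (A * C)%:E)%E.
Proof.
move=> mX mY X0 Y0 A0 C0 XA YC; apply/lee_addgt0Pr => e e0.
(* As [A] may be zero, it is enlarged to a positive [B] with [B C = A C + e]; [t = C / B] balances
   the two terms of [X Y <= t X^2 / 2 + Y^2 / (2 t)]. *)
pose B := A + e / C.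
have B0 : 0 < B by rewrite ltr_wpDl// divr_gt0.
pose t := C / B; have t0 : 0 < t by rewrite divr_gt0.
apply: (@le_trans _ _ (\int[P]_w ((t / 2)%:E * (X w ^+ 2)%:E + (t^-1 / 2)%:E * (Y w ^+ 2)%:E))%E).
  apply: ge0_le_integral => //.
  - by move=> w _; rewrite lee_fin mulr_ge0.
  - by apply/measurable_EFinP; exact: measurable_funM.
  - by apply: emeasurable_funD; apply: emeasurable_funM => //; apply/measurable_EFinP; exact: measurable_funX.
  - move=> w _; rewrite -!EFinM -EFinD lee_fin.
    have : 0 <= (t * X w - Y w) ^+ 2 / t by rewrite divr_ge0 ?sqr_ge0// ltW.
    rewrite (_ : _ / t = t * X w ^+ 2 - 2 * (X w * Y w) + t^-1 * Y w ^+ 2); first by lra.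
    by field; rewrite gt_eqF.
have mX2 : measurable_fun setT (fun w => (X w ^+ 2)%:E).
  by apply/measurable_EFinP; exact: measurable_funX.
have mY2 : measurable_fun setT (fun w => (Y w ^+ 2)%:E).
  by apply/measurable_EFinP; exact: measurable_funX.
have t20 : 0 <= t / 2 by rewrite divr_ge0// ltW.
have ti20 : 0 <= t^-1 / 2 by rewrite divr_ge0// invr_ge0 ltW.
rewrite ge0_integralD//; last 4 first.
- by move=> w _; rewrite -EFinM lee_fin mulr_ge0 ?sqr_ge0.
- exact: emeasurable_funM.
- by move=> w _; rewrite -EFinM lee_fin mulr_ge0 ?sqr_ge0.
- exact: emeasurable_funM.
rewrite !ge0_integralZl ?lee_fin//; last 2 first.
- by move=> w _; rewrite lee_fin sqr_ge0.
- by move=> w _; rewrite lee_fin sqr_ge0.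
apply: (@le_trans _ _ ((t / 2)%:E * (B ^+ 2)%:E + (t^-1 / 2)%:E * (C ^+ 2)%:E)%E).
  apply: leeD; apply: lee_wpmul2l; rewrite ?lee_fin//.
  apply: le_trans XA _; rewrite lee_fin lerXn2r ?nnegrE//; first exact: ltW.
  by rewrite lerDl divr_ge0// ltW.
rewrite -!EFinM -!EFinD lee_fin /t le_eqVlt; apply/orP; left; apply/eqP.
rewrite (_ : _ + _ = B * C); last by field; rewrite !gt_eqF.
by rewrite /B; field; rewrite gt_eqF.
Qed.

Lemma sqrt2_ge : 7 / 5 <= Num.sqrt 2 :> R.
Proof.
rewrite -(@ler_sqr R) ?nnegrE ?sqrtr_ge0 ?divr_ge0//.
by rewrite sqr_sqrtr//; lra.
Qed.

(** The term [4 m^3 G] has mean zero, and [4 m G^3 <= 3 m^2 G^2 + 4 G^4 / 3] absorbs the cubic one,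
    which yields the coefficients 9 and [7 / 3]. It remains that
    [9 * 64 / 7 <= 64 * 7 / 5 <= 64 sqrt 2] and [768 * 7 / 3 = 1792 <= 2048 = (32 sqrt 2)^2]. *)
Lemma fourth_moment_bound G (m t b : R) : P.-integrable setT (EFin \o G) ->
  (\int[P]_w (G w)%:E = 0)%E -> 0 <= b -> `|m| <= t ->
  (\int[P]_w (G w ^+ 2)%:E <= (64 / 7 * b)%:E)%E ->
  (\int[P]_w (G w ^+ 4)%:E <= (768 * b ^+ 2)%:E)%E ->
  (\int[P]_w ((m + G w) ^+ 4)%:E <= ((t ^+ 2 + 32 * Num.sqrt 2 * b) ^+ 2)%:E)%E.
Proof.
move=> iG G0 b0 mt G2 G4.
have mG : measurable_fun setT G by move/integrableP : iG => [/measurable_EFinP].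
have mGX k : measurable_fun setT (fun w => (G w ^+ k)%:E).
  by apply/measurable_EFinP; exact: measurable_funX.
have iGX k c : ~~ odd k -> (\int[P]_w (G w ^+ k)%:E <= c%:E)%E ->
    P.-integrable setT (fun w => (G w ^+ k)%:E).
  move=> ek Gc; apply/integrableP; split => //.
  under eq_integral do rewrite /= ger0_norm ?exprn_even_ge0//.
  by rewrite (le_lt_trans Gc)// ltry.
have i2 : P.-integrable setT (fun w => (G w ^+ 2)%:E) by exact: (iGX 2%N _ isT G2).
have i4 : P.-integrable setT (fun w => (G w ^+ 4)%:E) by exact: (iGX 4%N _ isT G4).
have iL := integrable_shift (m ^+ 4) (4 * m ^+ 3) iG.
have i2' := integrableZl measurableT (9 * m ^+ 2) i2.
have i4' := integrableZl measurableT (7 / 3) i4.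
apply: (@le_trans _ _ (\int[P]_w ((m ^+ 4 + 4 * m ^+ 3 * G w)%:E +
    ((9 * m ^+ 2)%:E * (G w ^+ 2)%:E + (7 / 3)%:E * (G w ^+ 4)%:E)))%E).
  have pw w : (m + G w) ^+ 4 <=
      m ^+ 4 + 4 * m ^+ 3 * G w + (9 * m ^+ 2 * G w ^+ 2 + 7 / 3 * G w ^+ 4).
    have := sqr_ge0 (3 * m * G w - 2 * G w ^+ 2).
    rewrite (_ : (3 * m * G w - 2 * G w ^+ 2) ^+ 2 = 9 * m ^+ 2 * G w ^+ 2 - 12 * m * G w ^+ 3 + 4 * G w ^+ 4); last by ring.
    rewrite (_ : (m + G w) ^+ 4 = m ^+ 4 + 4 * m ^+ 3 * G w + 6 * m ^+ 2 * G w ^+ 2 +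
      4 * m * G w ^+ 3 + G w ^+ 4); last by ring.
    lra.
  apply: ge0_le_integral => //.
  - by move=> w _; rewrite lee_fin exprn_even_ge0.
  - by apply/measurable_EFinP; apply: measurable_funX; exact: measurable_funD.
  - apply: emeasurable_funD; last first.
      by apply: emeasurable_funD; exact: emeasurable_funM.
    by apply/measurable_EFinP; apply: measurable_funD => //; exact: measurable_funM.
  - by move=> w _; rewrite -!EFinM -!EFinD lee_fin.
rewrite integralD//; last exact: integrableD.
rewrite integralD// (integral_shift _ _ iG G0) !integralZl//.
apply: (@le_trans _ _ ((m ^+ 4 + 4 * m ^+ 3 * 0)%:E + ((9 * m ^+ 2)%:E * (64 / 7 * b)%:E +
    (7 / 3)%:E * (768 * b ^+ 2)%:E))%E).
  apply: leeD => //; apply: leeD; apply: lee_wpmul2l; rewrite ?lee_fin ?divr_ge0//.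
  by rewrite mulr_ge0 ?sqr_ge0.
rewrite -!EFinM -!EFinD lee_fin.
have s2 := sqrt2_ge; have s22 : Num.sqrt 2 ^+ 2 = 2 :> R by rewrite sqr_sqrtr.
have m2t : m ^+ 2 <= t ^+ 2.
  by rewrite -(real_normK (num_real m)) lerXn2r ?nnegrE// (le_trans _ mt).
have mb : 0 <= m ^+ 2 * b by rewrite mulr_ge0 ?sqr_ge0.
apply: (@le_trans _ _ ((m ^+ 2 + 32 * Num.sqrt 2 * b) ^+ 2)); last first.
  rewrite lerXn2r ?nnegrE ?addr_ge0 ?sqr_ge0 ?mulr_ge0 ?sqrtr_ge0//.
  by rewrite lerD2r.
have -> : (m ^+ 2 + 32 * Num.sqrt 2 * b) ^+ 2 =
    m ^+ 4 + 64 * (Num.sqrt 2 * (m ^+ 2 * b)) + 2048 * b ^+ 2.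
  rewrite (_ : 2048 * b ^+ 2 = 1024 * Num.sqrt 2 ^+ 2 * b ^+ 2); last by rewrite s22; ring.
  ring.
have := ler_wpM2r mb s2; have := sqr_ge0 b; lra.
Qed.
End moment_bounds.

(** * The noise estimator *)

Section gaussian_norms.
Context {R : realType} {n : nat} {d} {T : measurableType d} (P : probability T R).
Variable K : 'rV[R]_n -> R.
Variable Z : T -> 'rV[R]_n.
Hypotheses (n5 : (5 <= n)%N) (K_norm : is_norm K) (gZ : gaussian_vector P Z 0 1).
Notation gam := (normal_prob (0 : R) 1).
Notation D := (dual_norm K).
Notation a := (dual_ball_radius K).

Let n0 : (0 < n)%N. Proof. exact: leq_trans n5. Qed.
Let nR : 5 <= n%:R :> R. Proof. by rewrite (ler_nat _ 5). Qed.
Let D_norm : is_norm D := dual_norm_is_norm n0 K_norm.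
Let a0 : 0 < a := dual_ball_radius_gt0 n0 K_norm.
Let mZ : forall i, measurable_fun setT (fun w => Z w 0 i) := gZ.1.

Let measurable_norm (N : 'rV[R]_n -> R) : is_norm N -> measurable_fun setT (fun w => N (Z w)).
Proof. by move=> nN; apply: measurable_comp_row => //; exact: norm_measurable. Qed.

Lemma integrable_dual_sqr : P.-integrable setT (fun w => (D (Z w) ^+ 2)%:E).
Proof.
have iN := integrableZl measurableT (norm_basis_sum D ^+ 2) (integrable_dotv gZ).
apply: le_integrable iN => //.
  by apply/measurable_EFinP; apply: measurable_funX; exact: measurable_norm.
move=> w _; rewrite -EFinM /= lee_fin ger0_norm ?sqr_ge0// ger0_norm; last first.
  by rewrite mulr_ge0 ?sqr_ge0 ?dotv_ge0.
rewrite -enorm_sqr -exprMn lerXn2r ?nnegrE ?(is_norm_ge0 D_norm)//.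
  by rewrite mulr_ge0 ?enorm_ge0 ?norm_basis_sum_ge0.
exact: norm_le_enorm.
Qed.

Definition dual_moment2 : R := fine (\int[P]_w (D (Z w) ^+ 2)%:E)%E.
Let M := dual_moment2.
Let EN : R := fine (\int[P]_w (dotv (Z w) (Z w))%:E)%E.

Lemma dual_moment2E : (\int[P]_w (D (Z w) ^+ 2)%:E = dual_moment2%:E)%E.
Proof.
by rewrite /dual_moment2 fineK//; apply: integrable_fin_num => //; exact: integrable_dual_sqr.
Qed.

Let ENE : (\int[P]_w (dotv (Z w) (Z w))%:E = EN%:E)%E.
Proof. by rewrite /EN fineK//; apply: integrable_fin_num => //; exact: integrable_dotv. Qed.

Let EN_ge : n%:R <= EN.
Proof.
rewrite -lee_fin -ENE integral_dotv_gaussian// -[leLHS]mule1.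
by apply: lee_wpmul2l; rewrite ?lee_fin//; exact: normal_second_moment_ge1.
Qed.

(** From [|x|^2 <= D(x) K(x) <= a D(x) |x|], the dual norm dominates [|x| / a]. *)
Lemma dual_moment2_gt0 : 0 < dual_moment2.
Proof.
have EN0 : 0 < EN by apply: lt_le_trans EN_ge; have := nR; lra.
suff : ((a ^- 2)%:E * EN%:E <= M%:E)%E.
  rewrite -EFinM lee_fin; apply: lt_le_trans.
  by rewrite mulr_gt0// invr_gt0 exprn_gt0.
rewrite /M -dual_moment2E -ENE -ge0_integralZl//; last 3 first.
- by move/integrableP : (integrable_dotv gZ) => [].
- by move=> w _; rewrite lee_fin dotv_ge0.
- by rewrite lee_fin invr_ge0 exprn_ge0// ltW.
apply: ge0_le_integral => //.
- by move=> w _; rewrite -EFinM lee_fin mulr_ge0 ?dotv_ge0// invr_ge0 exprn_ge0// ltW.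
- by apply: emeasurable_funM => //; move/integrableP : (integrable_dotv gZ) => [].
- by apply/measurable_EFinP; apply: measurable_funX; exact: measurable_norm.
move=> w _; rewrite -EFinM lee_fin mulrC ler_pdivrMr ?exprn_gt0//.
rewrite -enorm_sqr -exprMn lerXn2r ?nnegrE ?enorm_ge0 ?mulr_ge0 ?(is_norm_ge0 D_norm) ?(ltW a0)//.
have [->|z0] := eqVneq (Z w) 0.
  by rewrite (norm0 enorm_is_norm) mulr_ge0 ?(is_norm_ge0 D_norm)// ltW.
have e0 := enorm_gt0 z0.
rewrite -(ler_pM2r e0) -expr2 enorm_sqr -mulrA.
apply: le_trans (dotv_le_dual n0 K_norm _ _) _.
by rewrite ler_wpM2l ?(is_norm_ge0 D_norm)// norm_le_dual_ball_radius.
Qed.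

Let c := M / EN.
Let EN0 : 0 < EN. Proof. by apply: lt_le_trans EN_ge; have := nR; lra. Qed.
Let c0 : 0 < c. Proof. by rewrite divr_gt0// dual_moment2_gt0. Qed.
Let cM : c <= M / n%:R.
Proof. by rewrite ler_wpM2l ?(ltW dual_moment2_gt0)// lef_pV2 ?posrE// ltr0n. Qed.

Let U w := c * K (Z w) ^+ 2.
Let mU : measurable_fun setT U.
Proof. by apply: measurable_funM => //; apply: measurable_funX; exact: measurable_norm. Qed.
Let U0 w : 0 <= U w. Proof. by rewrite mulr_ge0 ?sqr_ge0// ltW. Qed.

(** With [s = exp r], the coefficient [(s^2 - 1) / 2] is [ltime r] and [s^-n] is [exp (- n r)],
    which explains the time change. The case [r = 0] is apart because [s > 1] is required. *)
Let laplaceU r : 0 <= r ->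
  (\int[P]_w (expR (- (ltime r * U w)))%:E <= (expR (- (n%:R * r)))%:E)%E.
Proof.
rewrite le_eqVlt => /predU1P[<-|r0].
  under eq_integral do rewrite ltime0 mul0r oppr0 expR0.
  by rewrite integral_cst_prob mulr0 oppr0 expR0.
have s1 : 1 < expR r by rewrite expR_gt1.
have sE : (expR r ^+ 2 - 1) / 2 = ltime r by rewrite -expRM_natl.
have := norm_sqr_laplace gZ K_norm D_norm (dotv_le_dual n0 K_norm) c0 s1 integrable_dual_sqr.
rewrite sE -expRN -expRM_natl mulrN; apply.
by rewrite dual_moment2E ENE -EFinM lee_fin divfK// gt_eqF.
Qed.

Lemma norm_inverse_moment2 :
  (\int[P]_w ((K (Z w) ^+ 2)^-1)%:E <= (M / (n%:R * (n%:R - 2)))%:E)%E.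
Proof.
have n2 : 2 < n%:R :> R by have := nR; lra.
have := negative_moment1 mU U0 laplaceU n2.
under eq_integral do rewrite /U invfM EFinM.
rewrite ge0_integralZl ?lee_fin//; last 3 first.
- apply/measurable_EFinP; apply: measurable_funV_ge0 => [|w]; last exact: sqr_ge0.
  by apply: measurable_funX; exact: measurable_norm.
- by move=> w _; rewrite lee_fin invr_ge0 sqr_ge0.
- by rewrite invr_ge0 ltW.
rewrite lee_pdivrMl// -EFinM => /le_trans; apply.
rewrite lee_fin invfM mulrA ler_wpM2r// invr_ge0; lra.
Qed.

Lemma norm_inverse_moment4 :
  (\int[P]_w (((K (Z w) ^+ 2)^-1) ^+ 2)%:E <=
   (M ^+ 2 / (n%:R ^+ 2 * ((n%:R - 2) * (n%:R - 4))))%:E)%E.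
Proof.
have n4 : 4 < n%:R :> R by have := nR; lra.
have := negative_moment2 mU U0 laplaceU n4.
under eq_integral do rewrite /U -exprVn invfM exprMn EFinM.
have ci0 : 0 < c^-1 ^+ 2 by rewrite exprn_gt0// invr_gt0.
rewrite ge0_integralZl ?lee_fin//; last 3 first.
- apply/measurable_EFinP; apply: measurable_funX; apply: measurable_funV_ge0 => [|w]; last exact: sqr_ge0.
  by apply: measurable_funX; exact: measurable_norm.
- by move=> w _; rewrite lee_fin sqr_ge0.
- exact: ltW.
rewrite -lee_pdivlMl// -EFinM => /le_trans; apply.
rewrite lee_fin exprVn invrK [leRHS](_ : _ = M ^+ 2 / n%:R ^+ 2 / ((n%:R - 2) * (n%:R - 4))).
  2: by rewrite invfM mulrA.
rewrite ler_wpM2r//.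
  by rewrite invr_ge0 mulr_ge0; lra.
by rewrite -expr_div_n lerXn2r ?nnegrE ?(ltW c0)// divr_ge0 ?(ltW dual_moment2_gt0).
Qed.

(** [K (Z w) = 0] forces the first coordinate to vanish, a null event since the normal law is
    absolutely continuous. *)
Lemma norm_neq0_ae : {ae P, forall w, K (Z w) != 0}.
Proof.
pose i0 := Ordinal n0.
have mi0 : measurable [set w | Z w 0 i0 = 0].
  have := mZ i0 measurableT (measurable_set1 (0 : R)); by rewrite setTI.
have g0 : gam [set 0] = 0%E.
  have /null_content_dominatesP := @normal_prob_dominates R 0 1.
  by apply; [exact: measurable_set1|exact: lebesgue_measure_set1].
have Pi0 : P [set w | Z w 0 i0 = 0] = 0%E.
  have mA (j : 'I_n) : measurable (if j == i0 then [set (0 : R)] else setT).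
    by case: ifP.
  have := gZ.2 _ mA.
  rewrite (_ : [set w | _] = [set w | Z w 0 i0 = 0]).
    move=> ->; rewrite (bigD1 i0)//= ?eqxx mxE /gaussian1 oner_eq0 sqrtr1.
    by rewrite [normal_prob _ _ _]g0 mul0e.
  apply/seteqP; split => w /=; first by move=> /(_ i0); rewrite eqxx.
  by move=> wA j; case: eqP => // ->.
exists [set w | Z w 0 i0 = 0]; split => // w /= /negP; rewrite negbK => /eqP Kz.
by rewrite (is_norm_eq0 K_norm Kz) mxE.
Qed.
End gaussian_norms.

(** * Mean square error of the estimator *)

Section noise_estimate.
Context {R : realType} {n : nat} {d} {T : measurableType d} (P : probability T R).
Variable K : 'rV[R]_n -> R.
Variables (mu : 'rV[R]_n) (sigma : R) (Y Z : T -> 'rV[R]_n).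
Hypotheses (n5 : (5 <= n)%N) (K_norm : is_norm K) (sigma0 : 0 <= sigma).
Hypotheses (gY : gaussian_vector P Y mu (sigma ^+ 2)) (gZ : gaussian_vector P Z 0 1).
Notation D := (dual_norm K).
Notation a := (dual_ball_radius K).

Let n0 : (0 < n)%N. Proof. exact: leq_trans n5. Qed.
Let nR : 5 <= n%:R :> R. Proof. by rewrite (ler_nat _ 5). Qed.
Let a0 : 0 < a := dual_ball_radius_gt0 n0 K_norm.
Let mK := norm_measurable K_norm.

Let norm_lip x y : K x <= K y + a * enorm (x - y).
Proof.
rewrite -lerBlDl; apply: le_trans (ler_norm _) _.
apply: le_trans (norm_dist K_norm _ _) _; exact: norm_le_dual_ball_radius.
Qed.

(* [Z] only provides a standard Gaussian vector on [T]; it is unrelated to [X]. *)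
Lemma norm_deviation (X : T -> 'rV[R]_n) (m : 'rV[R]_n) (s : R) : 0 <= s ->
  gaussian_vector P X m (s ^+ 2) -> exists e : R,
  [/\ P.-integrable setT (fun w => (K (X w))%:E),
      (\int[P]_w (K (X w))%:E = e%:E)%E,
      (\int[P]_w ((K (X w) - e) ^+ 2)%:E <= (16 / 7 * (s ^+ 2 * a ^+ 2))%:E)%E &
      (\int[P]_w ((K (X w) - e) ^+ 4)%:E <= (48 * (s ^+ 2 * a ^+ 2) ^+ 2)%:E)%E].
Proof.
move=> s0 gX; have gX' := gaussian_vector_affine m s0 gZ.
(* [X] has the law of [m + s Z], and [f] has Lipschitz constant [s a], whence the [s^2 a^2] in the
   moments. *)
pose f x := K (m + s *: x).
have fL x y : f x <= f y + s * a * enorm (x - y).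
  apply: le_trans (norm_lip _ (m + s *: y)) _.
  rewrite lerD2l (_ : m + s *: x - (m + s *: y) = s *: (x - y)); last first.
    by rewrite opprD addrACA subrr add0r scalerBr.
  by rewrite enormZ ger0_norm// mulrCA mulrA.
have L0 : 0 <= s * a by rewrite mulr_ge0// ltW.
have if_ := lipschitz_integrable gZ L0 fL.
have K0 x : 0 <= K x := is_norm_ge0 K_norm x.
have mKX : measurable_fun setT (fun w => K (X w)) := measurable_comp_row mK gX.1.
have KX : (\int[P]_w (K (X w))%:E = \int[P]_w (f (Z w))%:E)%E.
  apply: (@gaussian_vector_eq_law _ _ _ P n X (fun w => m + s *: Z w) m (s ^+ 2)
    (fun x => (K x)%:E)) => //; exact/measurable_EFinP.
have fin : (\int[P]_w (f (Z w))%:E)%E \is a fin_num by exact: integrable_fin_num.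
pose e := fine (\int[P]_w (f (Z w))%:E)%E.
have fe : (\int[P]_w (f (Z w))%:E = e%:E)%E by rewrite fineK.
have mgf t : (\int[P]_w (expR (t * (K (X w) - e)))%:E <= (expR (t ^+ 2 * (s ^+ 2 * a ^+ 2)))%:E)%E.
  rewrite -exprMn; apply: le_trans (lipschitz_mgf gZ L0 fL fe t).
  rewrite (@gaussian_vector_eq_law _ _ _ P n X (fun w => m + s *: Z w) m (s ^+ 2)
    (fun x => (expR (t * (K x - e)))%:E))//.
  - apply/measurable_EFinP; apply: measurableT_comp => //; apply: measurable_funM => //.
    exact: measurable_funB.
have mX' : measurable_fun setT (fun w => K (X w) - e) by exact: measurable_funB.
have b0 : 0 <= s ^+ 2 * a ^+ 2 by rewrite mulr_ge0 ?sqr_ge0.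
exists e; split.
- apply/integrableP; split; first exact/measurable_EFinP.
  under eq_integral do rewrite /= ger0_norm ?K0//.
  by rewrite KX fe ltry.
- by rewrite KX.
- exact: (mgf_moment2 mX' b0 mgf).
- exact: (mgf_moment4 mX' b0 mgf).
Qed.

Let b := sigma ^+ 2 * a ^+ 2.
Let M := dual_moment2 P K Z.
Let M0 : 0 < M := dual_moment2_gt0 n5 K_norm gZ.
Let b0 : 0 <= b. Proof. by rewrite mulr_ge0 ?sqr_ge0. Qed.

Let mKZ : measurable_fun setT (fun w => K (Z w)) := measurable_comp_row mK gZ.1.
Let mKY : measurable_fun setT (fun w => K (Y w)) := measurable_comp_row mK gY.1.

(** [K(Y)] and [K(Z)] are centred separately, so that only the two marginal laws matter. The
    constants are [64 / 7 = 2 (16 / 7 + 16 / 7)] and [768 = 8 (48 + 48)], from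
    [(x - y)^2 <= 2 x^2 + 2 y^2] and [(x - y)^4 <= 8 x^4 + 8 y^4]. *)
Lemma norm_difference_decomposition : exists (m : R) (G : T -> R),
  [/\ forall w, K (Y w) - sigma * K (Z w) = m + G w, `|m| <= K mu,
      P.-integrable setT (EFin \o G), (\int[P]_w (G w)%:E = 0)%E &
      (\int[P]_w (G w ^+ 2)%:E <= (64 / 7 * b)%:E)%E /\
      (\int[P]_w (G w ^+ 4)%:E <= (768 * b ^+ 2)%:E)%E].
Proof.
have gZ1 : gaussian_vector P Z 0 (1 ^+ 2) by rewrite expr1n.
have [eY [iY EY Y2 Y4]] := norm_deviation sigma0 gY.
have [eZ [iZ EZ Z2 Z4]] := norm_deviation ler01 gZ1.
move: Z2 Z4; rewrite expr1n !mul1r => Z2 Z4.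
pose X1 w := K (Y w) - eY; pose X2 w := sigma * (K (Z w) - eZ).
have mX1 : measurable_fun setT X1 by exact: measurable_funB.
have mX2 : measurable_fun setT X2 by apply: measurable_funM => //; exact: measurable_funB.
have mZe k : measurable_fun setT (fun w => ((K (Z w) - eZ) ^+ k)%:E).
  by apply/measurable_EFinP; apply: measurable_funX; exact: measurable_funB.
have X2k k C : ~~ odd k -> (\int[P]_w ((K (Z w) - eZ) ^+ k)%:E <= C%:E)%E ->
    (\int[P]_w (X2 w ^+ k)%:E <= (sigma ^+ k * C)%:E)%E.
  move=> ek ZC; under eq_integral do rewrite /X2 exprMn EFinM.
  rewrite ge0_integralZl//; last 2 first.
  - by move=> w _; rewrite lee_fin exprn_even_ge0.
  - by rewrite lee_fin exprn_ge0.
  by rewrite EFinM; apply: lee_wpmul2l => //; rewrite lee_fin exprn_ge0.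
pose G w := X1 w - X2 w.
have iG : P.-integrable setT (EFin \o G).
  rewrite (_ : _ \o _ = fun w => ((- eY + sigma * eZ) + 1 * K (Y w))%:E +
      (0 + (- sigma) * K (Z w))%:E)%E.
    by apply: integrableD => //; exact: integrable_shift.
  by apply/funext => w /=; rewrite -EFinD; congr (_%:E); rewrite /G /X1 /X2; ring.
have mG : measurable_fun setT G by exact: measurable_funB.
have Gk k (c C1 C2 : R) : ~~ odd k -> 0 <= c ->
    (forall x y : R, (x - y) ^+ k <= c * x ^+ k + c * y ^+ k) ->
    (\int[P]_w (X1 w ^+ k)%:E <= C1%:E)%E -> (\int[P]_w (X2 w ^+ k)%:E <= C2%:E)%E ->
    (\int[P]_w (G w ^+ k)%:E <= (c * C1 + c * C2)%:E)%E.
  move=> ek c0 xy H1 H2.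
  have m1 : measurable_fun setT (fun w => (X1 w ^+ k)%:E).
    by apply/measurable_EFinP; exact: measurable_funX.
  have m2 : measurable_fun setT (fun w => (X2 w ^+ k)%:E).
    by apply/measurable_EFinP; exact: measurable_funX.
  apply: (@le_trans _ _ (\int[P]_w (c%:E * (X1 w ^+ k)%:E + c%:E * (X2 w ^+ k)%:E))%E).
    apply: ge0_le_integral => //.
    - by move=> w _; rewrite lee_fin exprn_even_ge0.
    - by apply/measurable_EFinP; exact: measurable_funX.
    - by apply: emeasurable_funD; exact: emeasurable_funM.
    - by move=> w _; rewrite lee_fin; exact: xy.
  rewrite ge0_integralD//; last 4 first.
  - by move=> w _; rewrite -EFinM lee_fin mulr_ge0 ?exprn_even_ge0.
  - exact: emeasurable_funM.
  - by move=> w _; rewrite -EFinM lee_fin mulr_ge0 ?exprn_even_ge0.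
  - exact: emeasurable_funM.
  rewrite !ge0_integralZl ?lee_fin//; last 2 first.
  - by move=> w _; rewrite lee_fin exprn_even_ge0.
  - by move=> w _; rewrite lee_fin exprn_even_ge0.
  by rewrite EFinD !EFinM; apply: leeD; apply: lee_wpmul2l; rewrite ?lee_fin.
exists (eY - sigma * eZ), G; split.
- by move=> w; rewrite /G /X1 /X2; ring.
- (* [E K(Y) = E K(mu + sigma Z)], and [|K(mu + sigma Z) - sigma K(Z)| <= K mu]. *)
  have gX' := gaussian_vector_affine mu sigma0 gZ.
  have mX' : measurable_fun setT (fun w => K (mu + sigma *: Z w)) := measurable_comp_row mK gX'.1.
  have EX' : (\int[P]_w (K (mu + sigma *: Z w))%:E = eY%:E)%E.
    rewrite -EY; apply/esym.
    apply: (@gaussian_vector_eq_law _ _ _ P n Y (fun w => mu + sigma *: Z w) mu (sigma ^+ 2)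
      (fun x => (K x)%:E)) => //; first exact/measurable_EFinP.
    by move=> x; rewrite lee_fin (is_norm_ge0 K_norm).
  have iX' : P.-integrable setT (fun w => (K (mu + sigma *: Z w))%:E).
    apply/integrableP; split; first exact/measurable_EFinP.
    under eq_integral do rewrite /= ger0_norm ?(is_norm_ge0 K_norm)//.
    by rewrite EX' ltry.
  rewrite ler_norml; apply/andP; split.
    rewrite lerBrDr -lee_fin -EX' -(integral_shift (- K mu) sigma iZ EZ).
    apply: le_integral => //; first exact: integrable_shift.
    move=> w _; rewrite lee_fin -lerBrDl opprK.
    have := is_normD K_norm (mu + sigma *: Z w) (- mu).
    by rewrite (normN K_norm) addrAC subrr add0r (is_normZ K_norm) ger0_norm.
  rewrite lerBlDr -lee_fin -EX' -(integral_shift (K mu) sigma iZ EZ).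
  apply: le_integral => //; first exact: integrable_shift.
  move=> w _; rewrite lee_fin; apply: le_trans (is_normD K_norm _ _) _.
  by rewrite (is_normZ K_norm) ger0_norm.
- exact: iG.
- transitivity (\int[P]_w ((- eY + 1 * K (Y w))%:E + (sigma * eZ + (- sigma) * K (Z w))%:E))%E.
    by apply: eq_integral => w _; rewrite -EFinD; congr (_%:E); rewrite /G /X1 /X2; ring.
  rewrite integralD//; [|exact: integrable_shift|exact: integrable_shift].
  rewrite (integral_shift _ _ iY EY) (integral_shift _ _ iZ EZ) -EFinD.
  by congr (_%:E); ring.
- split.
    have := Gk 2%N 2 _ _ isT (ler0n _ _) _ Y2 (X2k 2%N _ isT Z2).
    rewrite (_ : 2 * _ + _ = 64 / 7 * b); first by apply => x y; have := sqr_ge0 (x + y); lra.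
    by rewrite /b; field.
  have := Gk 4%N 8 _ _ isT (ler0n _ _) _ Y4 (X2k 4%N _ isT Z4).
  rewrite (_ : 8 * _ + _ = 768 * b ^+ 2); last by rewrite /b; ring.
  apply => x y; have h1 := sqr_ge0 (x + y); have h2 := sqr_ge0 (x ^+ 2 - y ^+ 2).
  have h3 : ((x - y) ^+ 2) ^+ 2 <= (2 * x ^+ 2 + 2 * y ^+ 2) ^+ 2.
    have h4 : (x - y) ^+ 2 <= 2 * x ^+ 2 + 2 * y ^+ 2 by lra.
    by rewrite lerXn2r ?nnegrE ?sqr_ge0// (le_trans _ h4)// sqr_ge0.
  rewrite -exprM in h3; apply: (le_trans h3).
  by move: h2; lra.
Qed.

Let Q w := (K (Z w) ^+ 2)^-1.
Let mQ : measurable_fun setT Q.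
Proof. by apply: measurable_funV_ge0 => [|w]; [exact: measurable_funX|exact: sqr_ge0]. Qed.
Let Q0 w : 0 <= Q w. Proof. by rewrite invr_ge0 sqr_ge0. Qed.

Let mE (h : T -> R) : measurable_fun setT h -> measurable_fun setT (fun w => (h w ^+ 2)%:E).
Proof. by move=> mh; apply/measurable_EFinP; exact: measurable_funX. Qed.

Let Q4 (C : R) : M ^+ 2 / (n%:R ^+ 2 * ((n%:R - 2) * (n%:R - 4))) <= C ^+ 2 ->
  (\int[P]_w (Q w ^+ 2)%:E <= (C ^+ 2)%:E)%E.
Proof. by move=> MC; apply: le_trans (norm_inverse_moment4 n5 K_norm gZ) _; rewrite lee_fin. Qed.

(* In dimension 5 the bound on [E K(Z)^-4] is slightly too weak for a direct use of the
   Cauchy-Schwarz inequality, but there is room in the second term. *)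
Lemma ratio_bound5 : n = 5%N ->
  (\int[P]_w ((K (Y w) - sigma * K (Z w)) ^+ 2 * Q w)%:E <=
   (K mu ^+ 2 * (M / (n%:R - 2) ^+ 2) + 32 * Num.sqrt 2 * b * (M / (n%:R - 4) ^+ 2))%:E)%E.
Proof.
move=> n_5; have n5R : n%:R = 5 :> R by rewrite n_5.
have [m [G [WG mt iG G0 [G2 G4]]]] := norm_difference_decomposition.
have mG : measurable_fun setT G by move/integrableP : iG => [/measurable_EFinP].
under eq_integral do rewrite WG.
(* Here [28^2 = 784 >= 768], and [n^2 (n - 2) (n - 4) = 75 >= 8^2]. *)
have GQ : (\int[P]_w (G w ^+ 2 * Q w)%:E <= (28 * b * (M / 8))%:E)%E.
  have A0 : 0 <= 28 * b by rewrite mulr_ge0.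
  have C0 : 0 < M / 8 by rewrite divr_gt0.
  apply: cauchy_schwarz_integral => //.
  - exact: measurable_funX.
  - by move=> w; exact: sqr_ge0.
  - under eq_integral do rewrite -exprM.
    apply: le_trans G4 _; rewrite lee_fin [in leRHS]exprMn ler_wpM2r ?sqr_ge0//; lra.
  - apply: Q4; rewrite n5R expr_div_n ler_wpM2l ?sqr_ge0// lef_pV2 ?posrE; lra.
have Q2 : (\int[P]_w (Q w)%:E <= (M / 15)%:E)%E.
  apply: le_trans (norm_inverse_moment2 n5 K_norm gZ) _; rewrite lee_fin n5R.
  by rewrite ler_wpM2l ?(ltW M0)// lef_pV2 ?posrE; lra.
have mGQ : measurable_fun setT (fun w => (G w ^+ 2 * Q w)%:E).
  by apply/measurable_EFinP; apply: measurable_funM => //; exact: measurable_funX.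
have mQE : measurable_fun setT (fun w => (Q w)%:E) by exact/measurable_EFinP.
have c1 : 0 <= 5 / 3 * m ^+ 2 by rewrite mulr_ge0 ?sqr_ge0// divr_ge0.
have c2 : 0 <= 5 / 2 :> R by rewrite divr_ge0.
(* From [2 m G <= 2 m^2 / 3 + 3 G^2 / 2], weighted so that [5 / 3 * M / 15] is exactly
   [M / (n - 2)^2]. The other term, [5 / 2 * 28 / 8 = 35 / 4], is far below [32 sqrt 2]. *)
apply: (@le_trans _ _ (\int[P]_w ((5 / 3 * m ^+ 2)%:E * (Q w)%:E + (5 / 2)%:E * (G w ^+ 2 * Q w)%:E))%E).
  apply: ge0_le_integral => //.
  - by move=> w _; rewrite lee_fin mulr_ge0 ?sqr_ge0.
  - apply/measurable_EFinP; apply: measurable_funM => //; apply: measurable_funX.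
    exact: measurable_funD.
  - by apply: emeasurable_funD; exact: emeasurable_funM.
  - move=> w _; rewrite -!EFinM -EFinD lee_fin [5 / 2 * _]mulrA -mulrDl ler_wpM2r//.
    by have := sqr_ge0 (2 * m - 3 * G w); lra.
rewrite ge0_integralD//; last 4 first.
- by move=> w _; rewrite -EFinM lee_fin mulr_ge0.
- exact: emeasurable_funM.
- by move=> w _; rewrite -EFinM lee_fin mulr_ge0// mulr_ge0 ?sqr_ge0.
- exact: emeasurable_funM.
rewrite !ge0_integralZl ?lee_fin//; last 2 first.
- by move=> w _; rewrite lee_fin mulr_ge0// sqr_ge0.
- by move=> w _; rewrite lee_fin.
apply: (@le_trans _ _ ((5 / 3 * m ^+ 2)%:E * (M / 15)%:E + (5 / 2)%:E * (28 * b * (M / 8))%:E)%E).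
  by apply: leeD; apply: lee_wpmul2l; rewrite ?lee_fin.
rewrite -!EFinM -EFinD lee_fin n5R; apply: lerD.
  rewrite (_ : 5 / 3 * m ^+ 2 * _ = m ^+ 2 * (M / (5 - 2) ^+ 2)); last by field.
  rewrite ler_wpM2r ?divr_ge0 ?sqr_ge0 ?(ltW M0)//.
  by rewrite -(real_normK (num_real m)) lerXn2r ?nnegrE ?(is_norm_ge0 K_norm).
have bM : 0 <= b * M by rewrite mulr_ge0// ltW.
have := ler_wpM2r bM (@sqrt2_ge R).
rewrite (_ : (5 - 4) ^+ 2 = 1 :> R); last by ring.
by rewrite divr1; lra.
Qed.

Lemma ratio_bound6 : (6 <= n)%N ->
  (\int[P]_w ((K (Y w) - sigma * K (Z w)) ^+ 2 * Q w)%:E <=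
   (K mu ^+ 2 * (M / (n%:R - 2) ^+ 2) + 32 * Num.sqrt 2 * b * (M / (n%:R - 4) ^+ 2))%:E)%E.
Proof.
move=> n6; have n6R : 6 <= n%:R :> R by rewrite (ler_nat _ 6).
have [m [G [WG mt iG G0 [G2 G4]]]] := norm_difference_decomposition.
have mG : measurable_fun setT G by move/integrableP : iG => [/measurable_EFinP].
have W4 := fourth_moment_bound iG G0 b0 mt G2 G4.
under eq_integral do rewrite WG.
set N : R := n%:R in n6R *.
have N2 : 0 < N - 2 by lra.
have N4 : 0 < N - 4 by lra.
have sb0 : 0 <= 32 * Num.sqrt 2 * b by apply: mulr_ge0 => //; rewrite mulr_ge0 ?sqrtr_ge0.
have A0 : 0 <= K mu ^+ 2 + 32 * Num.sqrt 2 * b.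
  by rewrite addr_ge0 ?sqr_ge0.
have C0 : 0 < M / (N - 2) ^+ 2 by rewrite divr_gt0// exprn_gt0.
apply: (@le_trans _ _ ((K mu ^+ 2 + 32 * Num.sqrt 2 * b) * (M / (N - 2) ^+ 2))%:E).
  apply: cauchy_schwarz_integral => //.
  - by apply: measurable_funX; exact: measurable_funD.
  - by move=> w; exact: sqr_ge0.
  - by under eq_integral do rewrite -exprM.
  - have D0 : 0 < N ^+ 2 * ((N - 2) * (N - 4)).
      by apply: mulr_gt0; [rewrite exprn_gt0//; lra|exact: mulr_gt0].
    have D0' : 0 < ((N - 2) ^+ 2) ^+ 2 by rewrite exprn_gt0// exprn_gt0.
    (* After cancelling [N - 2], this is [(N - 2)^3 <= N^2 (N - 4)], false at 5, where it reads
       [27 <= 25], and true from 6 on. *)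
    apply: Q4; rewrite -/N expr_div_n ler_wpM2l ?sqr_ge0// lef_pV2 ?posrE//.
    rewrite -exprM (_ : (N - 2) ^+ (2 * 2) = (N - 2) * (N - 2) ^+ 3); last by rewrite -exprS.
    rewrite (_ : N ^+ 2 * (_ * _) = (N - 2) * (N ^+ 2 * (N - 4))); last by ring.
    rewrite ler_pM2l// -subr_ge0.
    rewrite (_ : _ - _ = 2 * (N * (N - 6)) + 8); last by ring.
    by rewrite addr_ge0// mulr_ge0// mulr_ge0; lra.
rewrite lee_fin mulrDl lerD2l ler_wpM2l//.
rewrite ler_wpM2l ?(ltW M0)// lef_pV2 ?posrE ?exprn_gt0//.
by rewrite lerXn2r ?nnegrE ?(ltW N2) ?(ltW N4)//; lra.
Qed.

Lemma ratio_bound :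
  (\int[P]_w ((K (Y w) / K (Z w) - sigma) ^+ 2)%:E <=
   (K mu ^+ 2 * (M / (n%:R - 2) ^+ 2) + 32 * Num.sqrt 2 * b * (M / (n%:R - 4) ^+ 2))%:E)%E.
Proof.
have mKV : measurable_fun setT (fun w => (K (Z w))^-1).
  by apply: measurable_funV_ge0 => // w; exact: (is_norm_ge0 K_norm).
rewrite (_ : (\int[P]_w _)%E =
    (\int[P]_w ((K (Y w) - sigma * K (Z w)) ^+ 2 * Q w)%:E)%E); last first.
  apply: ge0_ae_eq_integral => //.
  - apply/measurable_EFinP; apply: measurable_funX; apply: measurable_funB => //.
    exact: measurable_funM.
  - apply/measurable_EFinP; apply: measurable_funM => //; apply: measurable_funX.
    by apply: measurable_funB => //; exact: measurable_funM.
  - by move=> w _; rewrite lee_fin sqr_ge0.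
  - by move=> w _; rewrite lee_fin mulr_ge0 ?sqr_ge0.
  have := norm_neq0_ae n5 K_norm gZ; apply: filterS => w Kz _.
  by congr (_%:E); rewrite /Q; field.
have [/ratio_bound5//|n_neq5] := eqVneq n 5%N.
by apply: ratio_bound6; rewrite ltn_neqAle eq_sym n_neq5.
Qed.

(** Integrate [2 M D^2 <= D^4 + M^2]. This lets [m 4 ^ 2] replace [M] in the second term of the
    theorem, while the first keeps [M = m 2 ^ 2]. *)
Lemma dual_moment2_le_moment4 :
  ((M ^+ 2)%:E <= \int[P]_w (D (Z w) ^+ 4)%:E)%E.
Proof.
have D_norm := dual_norm_is_norm n0 K_norm.
have mD : measurable_fun setT (fun w => D (Z w)).
  exact: measurable_comp_row (norm_measurable D_norm) gZ.1.
have ED := dual_moment2E n5 K_norm gZ.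
suff : ((2 * M * M)%:E <= \int[P]_w (D (Z w) ^+ 4)%:E + (M ^+ 2)%:E)%E.
  by rewrite -leeBlDr// -EFinB; apply: le_trans; rewrite lee_fin; lra.
have M20 : 0 <= 2 * M by rewrite mulr_ge0// ltW.
rewrite EFinM -ED -ge0_integralZl//; last 2 first.
- exact: mE.
- by move=> w _; rewrite lee_fin sqr_ge0.
rewrite -(integral_cst_prob P (M ^+ 2)) -ge0_integralD//; last 3 first.
- by move=> w _; rewrite lee_fin -[4%N]/(2 * 2)%N exprM sqr_ge0.
- by apply/measurable_EFinP; exact: measurable_funX.
- by move=> w _; rewrite lee_fin sqr_ge0.
apply: ge0_le_integral => //.
- by move=> w _; rewrite -EFinM lee_fin mulr_ge0 ?sqr_ge0.
- by apply: emeasurable_funM => //; exact: (mE mD).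
- by apply: emeasurable_funD => //; apply/measurable_EFinP; exact: measurable_funX.
move=> w _; rewrite -EFinM -EFinD lee_fin.
by have := sqr_ge0 (D (Z w) ^+ 2 - M); lra.
Qed.
End noise_estimate.

Theorem theorem1p2 (R : realType) (n : nat) (n_ge5 : (5 <= n)%N)
    (K : 'rV[R]_n -> R) (K_norm : is_norm K)
    (d : measure_display) (T : measurableType d) (P : probability T R)
    (mu : 'rV[R]_n) (sigma : R) (sigma_ge0 : 0 <= sigma)
    (Y Z : T -> 'rV[R]_n)
    (Y_gauss : gaussian_vector P Y mu (sigma ^+ 2))
    (Z_gauss : gaussian_vector P Z 0 1) :
  let sigma_hat := fun w => K (Y w) / K (Z w) in
  let m := moment_root P (fun w => dual_norm K (Z w)) in
  let a := dual_ball_radius K in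
  ('E_P[fun w => ((sigma_hat w - sigma) ^+ 2)%R] <=
   (K mu ^+ 2)%R%:E * m 2%N ^+ 2 / ((n%:R - 2) ^+ 2)%R%:E +
   (32 * Num.sqrt 2 * sigma ^+ 2 * a ^+ 2)%R%:E * m 4%N ^+ 2
     / ((n%:R - 4) ^+ 2)%R%:E)%E.
Proof.
cbv zeta; set m := moment_root _ _; set a := dual_ball_radius K.
have nR : 5 <= n%:R :> R by rewrite (ler_nat _ 5).
have n2 : 0 < (n%:R - 2) ^+ 2 :> R by rewrite exprn_gt0//; lra.
have n4 : 0 < (n%:R - 4) ^+ 2 :> R by rewrite exprn_gt0//; lra.
have M0 := dual_moment2_gt0 n_ge5 K_norm Z_gauss.
have ED := dual_moment2E n_ge5 K_norm Z_gauss.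
have EM := dual_moment2_le_moment4 n_ge5 K_norm Z_gauss.
have RB := ratio_bound n_ge5 K_norm sigma_ge0 Y_gauss Z_gauss.
set M := dual_moment2 P K Z in M0 ED EM RB.
have m2E : (m 2%N ^+ 2 = M%:E)%E.
  rewrite /m /moment_root unlock ED poweR_EFin -EFin_expe; congr (_%:E).
  by rewrite powR12_sqrt ?(ltW M0)// sqr_sqrtr// ltW.
have m4E : (M%:E <= m 4%N ^+ 2)%E.
  rewrite /m /moment_root unlock.
  apply: (@le_trans _ _ ((((M ^+ 2)%:E) `^ (4%:R^-1)) ^+ 2)%E).
    rewrite poweR_EFin -EFin_expe lee_fin -[M ^+ 2]powR_mulrn ?(ltW M0)//.
    rewrite -powRrM -powR_mulrn ?powR_ge0// -powRrM.
    by rewrite (_ : _ * _ = 1) ?powRr1 ?(ltW M0)//; field.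
  have rootM : ((M ^+ 2)%:E `^ 4%:R^-1 <=
      (\int[P]_w (dual_norm K (Z w) ^+ 4)%:E) `^ 4%:R^-1)%E.
    apply: gt0_ler_poweR; rewrite ?in_itv/= ?leey ?andbT ?invr_ge0//.
    - by rewrite lee_fin sqr_ge0.
    - by apply: le_trans EM; rewrite lee_fin sqr_ge0.
  by rewrite !expe2; apply: lee_pmul; rewrite ?poweR_ge0.
rewrite m2E unlock !inver !gt_eqF//.
apply: (le_trans RB).
rewrite EFinD; apply: leeD; first by rewrite -!EFinM lee_fin mulrA.
rewrite -[X in (_ <= X%:E * _ * _)%E]mulrA [_ * (M / _)]mulrA EFinM.
apply: lee_wpmul2r; first by rewrite lee_fin invr_ge0 ltW.
rewrite EFinM; apply: lee_wpmul2l => //.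
by rewrite lee_fin; apply: mulr_ge0; apply: mulr_ge0; rewrite ?sqrtr_ge0 ?sqr_ge0.
Qed.
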